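(* Let $g_2,\lambda,g_3$ be parameters and let $\tau(z)=z+\sum_{n\ge 2}C_n z^{n+1}$ be the Taylor expansion at $z=0$ of the normalized tau-function of the first Painlevé equation $u''=6u^2-6\lambda z-\tfrac{1}{2}g_2$ associated with the solution $u(z;g_2,\lambda,g_3)$. Subject to fixing $C_0=1$, $C_1=0$, the coefficients $C_n$ are uniquely determined by the recursion $$ 4n(n^2-1)\,C_n=-\sum_{\substack{j+k+\ell+m=n\\ 0\le j,k,\ell,m\le n-1}}\tilde b_{j,k,\ell,m}\,C_jC_kC_\ell C_m+g_2\,S^{(4)}_n+12\lambda\,S^{(5)}_n-g_3\,S^{(6)}_n , $$ where $$ \tilde b_{j,k,\ell,m}=j(j+1)(k+1)\Big((j-1)\big(k(k-6\ell-7)+4(\ell+1)(m+1)\big)+k(\ell+1)(4\ell-3m-3)\Big) $$ and $$ S^{(4)}_n=\sum_{\substack{j+k+\ell+m=n-4\\0\le j,k,\ell,m\le n-4}}(j+1)(j-k-1)\,C_jC_kC_\ell C_m, $$ $$ S^{(5)}_n=\sum_{\substack{j+k+\ell+m=n-5\\0\le j,k,\ell,m\le n-5}}(j+1)(j-k-2)\,C_jC_kC_\ell C_m, \qquad S^{(6)}_n=\sum_{\substack{j+k+\ell+m=n-6\\0\le j,k,\ell,m\le n-6}}C_jC_kC_\ell C_m . $$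
   Context: For complex $g_2,\lambda,g_3$, $u(z)=u(z;g_2,\lambda,g_3)$ denotes the meromorphic solution on $\mathbb{C}$ of $\frac{d^2u}{dz^2}=6u^2-6\lambda z-\frac{g_2}{2}$ with a double pole at $z=0$ whose Laurent expansion there is $u(z)=\sum_{n\ge0}c_nz^{n-2}$ with $c_0=1$ and $c_6=g_3/28$ (all other coefficients are then determined by the differential equation; $c_6$ is the only free coefficient). A tau-function of $u$ is a holomorphic function $\tau$ with $u=-\frac{d^2}{dz^2}\log\tau$; it is defined up to $\tau\to e^{az+b}\tau$, and it has a simple zero at $z=0$. The normalized tau-function is the unique one with $\tau(0)=0$, $\tau'(0)=1$, $\tau''(0)=0$, so $\tau(z)=z+\sum_{n\ge2}C_nz^{n+1}$, and one sets $C_0=1$, $C_1=0$. Summation indices are integers, and empty sums are zero. *)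

(* Defs.v *)
From Stdlib Require Export Reals ZArith List.
From Coquelicot Require Export Coquelicot.

Open Scope C_scope.

Definition Cexp (z : C) : C :=
  (exp (Re z) * cos (Im z), exp (Re z) * sin (Im z))%R.

(** ** Holomorphic and meromorphic functions *)

Definition Cdifferentiable (f : C -> C) (z : C) : Prop :=
  ex_derive (K := C_AbsRing) (V := C_NormedModule) f z.

Definition holomorphic_at (f : C -> C) (z0 : C) : Prop :=
  locally z0 (fun z => Cdifferentiable f z).

Definition entire (f : C -> C) : Prop :=
  forall z, Cdifferentiable f z.

Definition pole (f : C -> C) (z0 : C) : Prop :=
  exists (m : nat) (h : C -> C),
    (1 <= m)%nat /\ holomorphic_at h z0 /\ h z0 <> 0 /\
    locally' z0 (fun z => f z = h z / (z - z0) ^ m).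

(* A meromorphic function on the plane is a total map [C -> C]; its values at
   its poles are irrelevant. *)
Definition meromorphic (f : C -> C) : Prop :=
  forall z, holomorphic_at f z \/ pole f z.

(** ** The solution [u(z; g2, lam, g3)] of the first Painleve equation *)

(* [C_derive] is a total operator that only evaluates limits along horizontal
   lines; it is the complex derivative wherever that exists, in particular at
   every point where the function is holomorphic. *)
Definition painleve1_solution (g2 lam g3 : C) (u : C -> C) : Prop :=
  meromorphic u /\
  (forall z, holomorphic_at u z ->
     C_derive (C_derive u) z = 6 * u z ^ 2 - 6 * lam * z - g2 / 2) /\
  exists c : nat -> C,
    c 0%nat = 1 /\ c 6%nat = g3 / 28 /\
    locally' (0 : C) (fun z =>
      is_series (K := C_AbsRing) (V := C_NormedModule)
        (fun n => c n * (z ^ n / z ^ 2)) (u z)).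

(** ** Tau-functions *)

(* [u = - (log tau)''], where [log tau] near a point at which [tau] does not
   vanish is any holomorphic branch [L] of the logarithm of [tau]; two branches
   differ by a locally constant function, hence have the same derivatives. *)
Definition tau_function (u tau : C -> C) : Prop :=
  entire tau /\
  (exists z, tau z <> 0) /\
  forall z, tau z <> 0 ->
    exists L : C -> C,
      holomorphic_at L z /\
      locally z (fun w => Cexp (L w) = tau w) /\
      u z = - C_derive (C_derive L) z.

Definition normalized_tau_function (u tau : C -> C) : Prop :=
  tau_function u tau /\
  tau 0 = 0 /\ C_derive tau 0 = 1 /\ C_derive (C_derive tau) 0 = 0.

Definition tau_taylor (tau : C -> C) (c : nat -> C) : Prop :=
  locally (0 : C) (fun z =>
    is_series (K := C_AbsRing) (V := C_NormedModule)
      (fun n => c n * z ^ (n + 1)) (tau z)).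

(** ** The recursion *)

(* Sum over the integers [0 <= j <= b]; it is zero when [b < 0]. *)
Definition Zsum (b : Z) (f : Z -> C) : C :=
  fold_right Cplus 0 (map (fun j => f (Z.of_nat j)) (List.seq 0 (Z.to_nat (b + 1)))).

(* Sum of [w j k l m * c_j * c_k * c_l * c_m] over the integers
   [0 <= j, k, l, m <= b] such that [j + k + l + m = s]. *)
Definition quad_sum (c : nat -> C) (s b : Z) (w : Z -> Z -> Z -> Z -> Z) : C :=
  Zsum b (fun j => Zsum b (fun k => Zsum b (fun l => Zsum b (fun m =>
    if (j + k + l + m =? s)%Z
    then RtoC (IZR (w j k l m)) *
         (c (Z.to_nat j) * c (Z.to_nat k) * c (Z.to_nat l) * c (Z.to_nat m))
    else 0)))).

Definition btilde (j k l m : Z) : Z :=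
  (j * (j + 1) * (k + 1) *
   ((j - 1) * (k * (k - 6 * l - 7) + 4 * (l + 1) * (m + 1))
    + k * (l + 1) * (4 * l - 3 * m - 3)))%Z.

Definition S4 (c : nat -> C) (n : Z) : C :=
  quad_sum c (n - 4) (n - 4) (fun j k l m => (j + 1) * (j - k - 1))%Z.

Definition S5 (c : nat -> C) (n : Z) : C :=
  quad_sum c (n - 5) (n - 5) (fun j k l m => (j + 1) * (j - k - 2))%Z.

Definition S6 (c : nat -> C) (n : Z) : C :=
  quad_sum c (n - 6) (n - 6) (fun j k l m => 1)%Z.

Definition tau_recursion (g2 lam g3 : C) (c : nat -> C) (n : nat) : Prop :=
  let N := Z.of_nat n in
  RtoC (IZR (4 * N * (N ^ 2 - 1))) * c n =
    - quad_sum c N (N - 1) btilde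
    + g2 * S4 c N + 12 * lam * S5 c N - g3 * S6 c N.

(* Main.v *)
Require Import Defs.
From Stdlib Require Import Lra Lia.

(* Write T0 = tau and Ti for its i-th derivative. Since u = (T1^2 - T0 T2) / T0^2,
   the Painleve equation becomes Hirota's bilinear equation
     T0 T4 - 4 T1 T3 + 3 T2^2 = (6 lam z + g2 / 2) T0^2,
   and its first integral u'^2 - 4 u^3 + g2 u + 12 lam (z u + T1 / T0) = - g3
   becomes a quartic equation in T0, T1, T2, T3. The recursion is the coefficient
   of z^(n-2) in this quartic equation, the terms with an index equal to n giving
   its left-hand side. The value - g3 of the constant comes from C_2 = C_3 = 0 and
   from the relation c_6 = - 30 C_6 between the coefficients of u and tau. *)

(** * Complex differentiation *)

(** Hirota's equation alone cannot yield the recursion: in it [C_n] carries the factor (n - 6)(n -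
    1)n(n + 1), which vanishes at n = 6, exactly where the coefficient is free. The first integral
    contains [g3] explicitly, and its factor 4n(n^2 - 1) is nonzero for every n >= 2; the price is
    degree four instead of two. Fixing the constant of integration costs a single coefficient: the
    quartic form G satisfies T0 G' = 4 T1 G, whose power series solutions are the multiples of tau^4
    = z^4 + ..., so G vanishes once its coefficient of z^4 does. That coefficient is 840 C_6 + g3.
    The obstacle is the origin, where tau vanishes and u has its pole, although every coefficient is
    read off there. Identities involving u or a logarithm of tau are therefore proved at points near
    0 where tau is nonzero, cleared of denominators, and carried over to Taylor coefficients by an
    identity theorem on punctured neighbourhoods. The expansion at 0 also supplies the higher
    derivatives of tau, since [entire] speaks of the first one only. *)

Notation Cderives f z l :=
  (is_derive (K := C_AbsRing) (V := C_NormedModule) (f : C -> C) (z : C) (l : C)).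
Notation Cseries a l :=
  (is_series (K := C_AbsRing) (V := C_NormedModule) (a : nat -> C) (l : C)).

(** The topology of [C] is that of the product [R * R], whose balls are squares. Discs generate the
    same neighbourhoods, and every later estimate is made in [Cmod]. *)
Lemma locally_Cmod (z : C) (P : C -> Prop) :
  locally z P <->
  exists d : R, (0 < d)%R /\ forall w, (Cmod (w - z) < d)%R -> P w.
Proof.
split.
- intros [e He]; exists e; split; [apply cond_pos|].
  intros w Hw; apply He, C_NormedModule_mixin_compat1; exact Hw.
- intros [d [Hd H]]; apply (proj2 (locally_C z P)).
  exists (mkposreal d Hd); intros w Hw; apply H; exact Hw.
Qed.

Lemma locally'_Cmod (z : C) (P : C -> Prop) :
  locally' z P <->
  exists d : R, (0 < d)%R /\ forall w, (Cmod (w - z) < d)%R -> w <> z -> P w.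
Proof. exact (locally_Cmod z (fun w => w <> z -> P w)). Qed.

Lemma Cderives_eps (f : C -> C) (z l : C) :
  Cderives f z l <->
  forall eps : R, (0 < eps)%R -> exists d : R, (0 < d)%R /\
    forall w, (Cmod (w - z) < d)%R ->
      (Cmod (f w - f z - (w - z) * l) <= eps * Cmod (w - z))%R.
Proof.
split.
- intros [_ H] eps He.
  specialize (H z (fun P HP => HP) (mkposreal eps He)).
  destruct H as [d Hd]; exists d; split; [apply cond_pos|].
  intros w Hw; exact (Hd w Hw).
- intros H; split; [apply is_linear_scal_l|].
  intros x Hx eps.
  rewrite <- (is_filter_lim_locally_unique _ _ Hx).
  destruct (H eps (cond_pos eps)) as [d [Hd H']].
  exists (mkposreal d Hd); intros w Hw; exact (H' w Hw).
Qed.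

Lemma Cderives_ext (f g : C -> C) (z l : C) :
  locally z (fun w => f w = g w) -> Cderives f z l -> Cderives g z l.
Proof.
rewrite locally_Cmod, !Cderives_eps; intros [d [Hd H]] Hf eps He.
destruct (Hf eps He) as [d' [Hd' H']].
exists (Rmin d d'); split; [apply Rmin_pos; assumption|].
intros w Hw; rewrite <- H, <- (H z); [apply H'| |].
- eapply Rlt_le_trans, Rmin_r; exact Hw.
- replace (z - z) with (RtoC 0) by ring; rewrite Cmod_0; exact Hd.
- eapply Rlt_le_trans, Rmin_l; exact Hw.
Qed.

Lemma Cderives_holomorphic (f g : C -> C) (z : C) :
  locally z (fun w => Cderives f w (g w)) -> holomorphic_at f z.
Proof.
intros H; unfold holomorphic_at; revert H.
apply filter_imp; intros w Hw; exists (g w); exact Hw.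
Qed.

Lemma holomorphic_Cderives (f : C -> C) (z : C) :
  holomorphic_at f z -> locally z (fun w => Cderives f w (C_derive f w)).
Proof.
unfold holomorphic_at; apply filter_imp; intros w Hw.
apply C_derive_correct; [exact w|exact Hw].
Qed.

Lemma C_derive_ext (f g : C -> C) (z l : C) :
  locally z (fun w => f w = g w) -> Cderives g z l -> C_derive f z = l.
Proof.
intros H Hg; apply is_C_derive_unique.
apply Cderives_ext with g; [|exact Hg].
revert H; apply filter_imp; auto.
Qed.

Lemma Cderives_continuous (f : C -> C) (z l : C) :
  Cderives f z l -> forall eps : R, (0 < eps)%R ->
  locally z (fun w => (Cmod (f w - f z) < eps)%R).
Proof.
rewrite Cderives_eps; intros H eps He; apply locally_Cmod.
destruct (H 1%R Rlt_0_1) as [d [Hd H']].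
pose proof (Cmod_ge_0 l) as Hl.
assert (He' : (0 < eps / (2 + Cmod l))%R) by (apply Rdiv_lt_0_compat; lra).
exists (Rmin d (eps / (2 + Cmod l))); split; [apply Rmin_pos; assumption|].
intros w Hw.
assert (H1 := H' w (Rlt_le_trans _ _ _ Hw (Rmin_l _ _))).
assert (H2 := Rlt_le_trans _ _ _ Hw (Rmin_r _ _)).
apply (Rmult_lt_compat_r (2 + Cmod l)) in H2; [|lra].
replace (eps / (2 + Cmod l) * (2 + Cmod l))%R with eps in H2 by (field; lra).
replace (f w - f z) with (f w - f z - (w - z) * l + (w - z) * l) by ring.
eapply Rle_lt_trans; [apply Cmod_triangle|]; rewrite Cmod_mult.
pose proof (Cmod_ge_0 (w - z)); nra.
Qed.

Lemma Cderives_neq0 (f : C -> C) (z l : C) :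
  Cderives f z l -> f z <> 0 -> locally z (fun w => f w <> 0).
Proof.
intros Hf Hz; apply Cmod_gt_0 in Hz.
generalize (Cderives_continuous f z l Hf _ Hz).
apply filter_imp; intros w Hw E; rewrite E in Hw.
replace (0 - f z) with (- f z) in Hw by ring; rewrite Cmod_opp in Hw; lra.
Qed.

Lemma Cderives_const (k z : C) : Cderives (fun _ => k) z 0.
Proof. apply (is_derive_const (K := C_AbsRing) (V := C_NormedModule)). Qed.

Lemma Cderives_id (z : C) : Cderives (fun w => w) z 1.
Proof.
apply Cderives_eps; intros eps He; exists 1%R; split; [lra|]; intros w _.
replace (w - z - (w - z) * 1) with (RtoC 0) by ring; rewrite Cmod_0.
apply Rmult_le_pos; [lra|apply Cmod_ge_0].
Qed.

Lemma Cderives_plus (f g : C -> C) (z l m : C) :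
  Cderives f z l -> Cderives g z m -> Cderives (fun w => f w + g w) z (l + m).
Proof. apply (is_derive_plus (K := C_AbsRing) (V := C_NormedModule)). Qed.

Lemma Cderives_minus (f g : C -> C) (z l m : C) :
  Cderives f z l -> Cderives g z m -> Cderives (fun w => f w - g w) z (l - m).
Proof. apply (is_derive_minus (K := C_AbsRing) (V := C_NormedModule)). Qed.

Lemma Cderives_mult (f g : C -> C) (z l m : C) :
  Cderives f z l -> Cderives g z m ->
  Cderives (fun w => f w * g w) z (l * g z + f z * m).
Proof.
intros Hf Hg.
(* The product rule is stated for values in the ring regarded as a module over itself. That
   structure and [C_NormedModule] differ in their balls, but the error estimate of a derivative
   involves only the norm, which is [Cmod] in both. *)
assert (Hf' : is_derive (K := C_AbsRing) (V := AbsRing_NormedModule C_AbsRing) f z l).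
{ split; [apply is_linear_scal_l|]. destruct Hf as [_ H]; exact H. }
assert (Hg' : is_derive (K := C_AbsRing) (V := AbsRing_NormedModule C_AbsRing) g z m).
{ split; [apply is_linear_scal_l|]. destruct Hg as [_ H]; exact H. }
assert (H := is_derive_mult f g z l m Hf' Hg' Cmult_comm).
split; [apply is_linear_scal_l|]. destruct H as [_ H]; exact H.
Qed.

Lemma Cderives_inv (f : C -> C) (z l : C) :
  Cderives f z l -> f z <> 0 ->
  Cderives (fun w => / f w) z (- l / (f z) ^ 2).
Proof.
intros Hf Hz.
assert (Hn := Cderives_neq0 f z l Hf Hz).
apply Cderives_eps; intros eps He.
pose proof (proj1 (Cmod_gt_0 _) Hz) as Hp.
set (p := Cmod (f z)) in *.
pose proof (Cmod_ge_0 l) as Hl.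
(* The error is a quotient with denominator [f w * f z ^ 2], of modulus at least p^3 / 2 once [f w]
   exceeds p / 2. Its numerator has two terms; the constants give each of them the share eps p^3 / 4
   times [Cmod (w - z)]. The summand 1 in [1 + Cmod l] covers l = 0. *)
assert (He1 : (0 < eps * p ^ 2 / 4)%R) by (apply Rdiv_lt_0_compat; [|lra]; apply Rmult_lt_0_compat; [lra|nra]).
destruct (proj1 (Cderives_eps f z l) Hf _ He1) as [d1 [Hd1 H1]].
assert (He2 : (0 < Rmin (p / 2) (eps * p ^ 3 / (4 * (1 + Cmod l))))%R).
{ apply Rmin_pos; [lra|]. apply Rdiv_lt_0_compat; [|lra].
  apply Rmult_lt_0_compat; [lra|]. apply pow_lt; lra. }
assert (H2 := Cderives_continuous f z l Hf _ He2).
apply locally_Cmod in H2; destruct H2 as [d2 [Hd2 H2]].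
apply locally_Cmod in Hn; destruct Hn as [d3 [Hd3 H3]].
exists (Rmin d1 (Rmin d2 d3)); split; [repeat apply Rmin_pos; assumption|].
intros w Hw.
assert (Hw1 := Rlt_le_trans _ _ _ Hw (Rmin_l _ _)).
assert (Hw' := Rlt_le_trans _ _ _ Hw (Rmin_r _ _)).
assert (Hw2 := Rlt_le_trans _ _ _ Hw' (Rmin_l _ _)).
assert (Hw3 := Rlt_le_trans _ _ _ Hw' (Rmin_r _ _)).
specialize (H1 w Hw1); specialize (H2 w Hw2); specialize (H3 w Hw3).
assert (H4 := Rlt_le_trans _ _ _ H2 (Rmin_l _ _)).
assert (H5 := Rlt_le_trans _ _ _ H2 (Rmin_r _ _)).
replace (/ f w - / f z - (w - z) * (- l / f z ^ 2)) with
  ((- (f w - f z - (w - z) * l) * f z + (w - z) * l * (f w - f z)) / (f w * (f z) ^ 2))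
  by (field; auto).
assert (Hq : (p / 2 < Cmod (f w))%R).
{ assert (T := Cmod_triangle (f w) (- (f w - f z))).
  replace (f w + - (f w - f z)) with (f z) in T by ring.
  rewrite Cmod_opp in T; fold p in T; lra. }
rewrite Cmod_div, Cmod_mult, Cmod_pow by (apply Cmult_neq_0; [|apply Cpow_nz]; assumption).
fold p.
apply Rle_div_l; [apply Rmult_lt_0_compat; nra|].
eapply Rle_trans; [apply Cmod_triangle|].
rewrite !Cmod_mult, Cmod_opp; fold p.
set (A := Cmod (f w - f z - (w - z) * l)) in *.
set (B := Cmod (f w - f z)) in *.
pose proof (Cmod_ge_0 (w - z)) as Hh.
set (h := Cmod (w - z)) in *.
assert (HB : (B * (4 * (1 + Cmod l)) <= eps * p ^ 3)%R).
{ apply Rlt_le in H5. apply Rle_div_r in H5; [exact H5|lra]. }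
assert (0 <= B)%R by apply Cmod_ge_0.
assert (A * p <= eps * p ^ 3 / 4 * h)%R by (replace (eps * p ^ 3 / 4 * h)%R with (eps * p ^ 2 / 4 * h * p)%R by field; apply Rmult_le_compat_r; lra).
assert (Cmod l * B <= eps * p ^ 3 / 4)%R by nra.
assert (h * Cmod l * B <= eps * p ^ 3 / 4 * h)%R by (rewrite Rmult_assoc, (Rmult_comm _ h); apply Rmult_le_compat_l; assumption).
assert (eps * h * (p / 2 * p ^ 2) <= eps * h * (Cmod (f w) * p ^ 2))%R.
{ apply Rmult_le_compat_l; [nra|]. apply Rmult_le_compat_r; nra. }
nra.
Qed.

Lemma Cderives_div (f g : C -> C) (z l m : C) :
  Cderives f z l -> Cderives g z m -> g z <> 0 ->
  Cderives (fun w => f w / g w) z ((l * g z - f z * m) / (g z) ^ 2).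
Proof.
intros Hf Hg Hz.
replace ((l * g z - f z * m) / g z ^ 2) with (l * / g z + f z * (- m / g z ^ 2))
  by (field; assumption).
apply (Cderives_mult f (fun w => / g w)); [|apply Cderives_inv]; assumption.
Qed.

Lemma Cderives_pow (f : C -> C) (z l : C) (n : nat) :
  Cderives f z l ->
  Cderives (fun w => f w ^ n) z (INR n * l * f z ^ (pred n)).
Proof.
intros Hf; induction n as [|n IH].
- simpl; replace (0 * l * 1) with (RtoC 0) by ring; apply Cderives_const.
- replace (INR (S n) * l * f z ^ pred (S n)) with
    (l * f z ^ n + f z * (INR n * l * f z ^ pred n)).
  + apply (Cderives_mult f (fun w => f w ^ n)); assumption.
  + rewrite S_INR, RtoC_plus; destruct n as [|n]; simpl; ring.
Qed.

(** * Power series *)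

Lemma sum_n_components (a : nat -> C) (n : nat) :
  sum_n (G := C_AbelianMonoid) a n =
  (sum_n (fun k => Re (a k)) n, sum_n (fun k => Im (a k)) n).
Proof.
induction n as [|n IH].
- rewrite !sum_O; apply surjective_pairing.
- rewrite !sum_Sn, IH; reflexivity.
Qed.

Lemma Cseries_components (a : nat -> C) (l : C) :
  Cseries a l <->
  is_series (fun n => Re (a n)) (Re l) /\ is_series (fun n => Im (a n)) (Im l).
Proof.
split.
- intros H; split; apply filterlim_locally; intros eps;
  generalize (proj1 (filterlim_locally _ _) H eps); apply filter_imp; intros n Hn;
  rewrite sum_n_components in Hn; apply Hn.
- intros [H1 H2]; apply filterlim_locally; intros eps.
  generalize (filter_and _ _ (proj1 (filterlim_locally _ _) H1 eps)
                             (proj1 (filterlim_locally _ _) H2 eps)).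
  apply filter_imp; intros n [Hn1 Hn2]; rewrite sum_n_components.
  split; assumption.
Qed.

Lemma Cseries_ext (a b : nat -> C) (l : C) :
  (forall n, a n = b n) -> Cseries a l -> Cseries b l.
Proof. apply is_series_ext. Qed.

Lemma Cseries_unique (a : nat -> C) (l m : C) :
  Cseries a l -> Cseries a m -> l = m.
Proof.
rewrite !Cseries_components; intros [H1 H2] [H3 H4].
apply injective_projections.
- apply is_series_unique in H1; apply is_series_unique in H3.
  unfold Re in *; congruence.
- apply is_series_unique in H2; apply is_series_unique in H4.
  unfold Im in *; congruence.
Qed.

Lemma Cmod_sum_n (a : nat -> C) (n : nat) :
  (Cmod (sum_n (G := C_AbelianMonoid) a n) <= sum_n (fun k => Cmod (a k)) n)%R.
Proof.
induction n as [|n IH].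
- rewrite !sum_O; apply Rle_refl.
- rewrite !sum_Sn; eapply Rle_trans; [apply Cmod_triangle|].
  apply Rplus_le_compat_r, IH.
Qed.

Lemma Cseries_Cmod_le (a : nat -> C) (b : nat -> R) (l : C) (s : R) :
  Cseries a l -> is_series b s -> (forall n, (Cmod (a n) <= b n)%R) ->
  (Cmod l <= s)%R.
Proof.
intros Ha Hb Hab.
assert (Hl : filterlim (fun n => Cmod (sum_n (G := C_AbelianMonoid) a n))
               eventually (locally (Cmod l))).
{ apply (filterlim_comp _ _ _ _ _ _ _ _ Ha
    (filterlim_norm (K := C_AbsRing) (V := C_NormedModule) l)). }
apply (filterlim_le (F := eventually) _ _ (Cmod l) s) with (2 := Hl) (3 := Hb).
exists 0%nat; intros n _; simpl.
eapply Rle_trans; [apply Cmod_sum_n|].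
rewrite !sum_n_Reals; apply sum_Rle; intros; apply Hab.
Qed.

Lemma ex_series_dominated (a b : nat -> R) :
  (forall n, (0 <= a n <= b n)%R) -> ex_series b -> ex_series a.
Proof.
intros H; apply (ex_series_le (K := R_AbsRing) (V := R_CompleteNormedModule)).
intros n; unfold norm; simpl; unfold abs; simpl.
rewrite Rabs_pos_eq; apply H.
Qed.

Definition conv (a b : nat -> C) (n : nat) : C :=
  sum_n (G := C_AbelianMonoid) (fun k => a k * b (n - k)%nat) n.

(** Splitting into components reduces the claim to four real Cauchy products, absolutely convergent
    because a component is bounded by the modulus. *)
Lemma Cseries_mult (a b : nat -> C) (l m : C) :
  Cseries a l -> Cseries b m ->
  ex_series (fun n => Cmod (a n)) -> ex_series (fun n => Cmod (b n)) ->
  Cseries (conv a b) (l * m).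
Proof.
rewrite !Cseries_components; intros [Har Hai] [Hbr Hbi] Ha Hb.
assert (Hre : forall a, ex_series (fun n => Cmod (a n)) -> ex_series (fun n => Rabs (Re (a n)))).
{ intros c; apply ex_series_dominated; intros n; split; [apply Rabs_pos|apply re_le_Cmod]. }
assert (Him : forall a, ex_series (fun n => Cmod (a n)) -> ex_series (fun n => Rabs (Im (a n)))).
{ intros c; apply ex_series_dominated; intros n; split; [apply Rabs_pos|].
  eapply Rle_trans, Rmax_Cmod; apply Rmax_r. }
split.
- eapply is_series_ext; [|apply (is_series_minus (V := R_NormedModule));
    [exact (is_series_mult _ _ _ _ Har Hbr (Hre _ Ha) (Hre _ Hb))
    |exact (is_series_mult _ _ _ _ Hai Hbi (Him _ Ha) (Him _ Hb))]].
  intros n; unfold conv; rewrite sum_n_components; simpl.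
  rewrite sum_n_Reals; unfold plus, opp; simpl.
  rewrite <- Rminus_def, <- minus_sum; reflexivity.
- eapply is_series_ext; [|apply (is_series_plus (V := R_NormedModule));
    [exact (is_series_mult _ _ _ _ Har Hbi (Hre _ Ha) (Him _ Hb))
    |exact (is_series_mult _ _ _ _ Hai Hbr (Him _ Ha) (Hre _ Hb))]].
  intros n; unfold conv; rewrite sum_n_components; simpl.
  rewrite sum_n_Reals; unfold plus; simpl.
  rewrite <- plus_sum; reflexivity.
Qed.

(** Absolute convergence at the radius [r] itself is built in: Cauchy products and termwise
    differentiation both rest on it. *)
Definition expands (f : C -> C) (a : nat -> C) : Prop :=
  exists r : R, (0 < r)%R /\ ex_series (fun n => Cmod (a n) * r ^ n)%R /\
    forall z, (Cmod z < r)%R -> Cseries (fun n => a n * z ^ n) (f z).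

Lemma Cmod_term (a z : C) (n : nat) : Cmod (a * z ^ n) = (Cmod a * Cmod z ^ n)%R.
Proof. rewrite Cmod_mult, Cmod_pow; reflexivity. Qed.

Lemma ex_series_shrink (a : nat -> C) (r s : R) :
  (0 <= s <= r)%R -> ex_series (fun n => Cmod (a n) * r ^ n)%R ->
  ex_series (fun n => Cmod (a n) * s ^ n)%R.
Proof.
intros Hs; apply ex_series_dominated; intros n; split.
- apply Rmult_le_pos; [apply Cmod_ge_0|apply pow_le, Hs].
- apply Rmult_le_compat_l; [apply Cmod_ge_0|apply pow_incr, Hs].
Qed.

Lemma expands_common (f g : C -> C) (a b : nat -> C) :
  expands f a -> expands g b ->
  exists r : R, (0 < r)%R /\
    ex_series (fun n => Cmod (a n) * r ^ n)%R /\
    ex_series (fun n => Cmod (b n) * r ^ n)%R /\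
    forall z, (Cmod z < r)%R ->
      Cseries (fun n => a n * z ^ n) (f z) /\ Cseries (fun n => b n * z ^ n) (g z).
Proof.
intros [r [Hr [Ha Hf]]] [s [Hs [Hb Hg]]].
pose proof (Rmin_l r s); pose proof (Rmin_r r s).
assert (0 < Rmin r s)%R by (apply Rmin_pos; assumption).
exists (Rmin r s); repeat split.
- assumption.
- apply ex_series_shrink with r; [lra|assumption].
- apply ex_series_shrink with s; [lra|assumption].
- apply Hf; lra.
- apply Hg; lra.
Qed.

Lemma expands_ext (f g : C -> C) (a b : nat -> C) :
  locally (0 : C) (fun z => f z = g z) -> (forall n, a n = b n) ->
  expands f a -> expands g b.
Proof.
rewrite locally_Cmod; intros [d [Hd H]] Hab [r [Hr [Ha Hf]]].
pose proof (Rmin_l r d); pose proof (Rmin_r r d).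
assert (0 < Rmin r d)%R by (apply Rmin_pos; assumption).
exists (Rmin r d); repeat split.
- assumption.
- eapply ex_series_ext; [intros n; rewrite <- Hab; reflexivity|].
  apply ex_series_shrink with r; [lra|assumption].
- intros z Hz; apply Cseries_ext with (fun n => a n * z ^ n).
  + intros n; rewrite Hab; reflexivity.
  + rewrite <- H; [apply Hf; lra|].
    replace (z - 0) with z by ring; lra.
Qed.

Lemma expands_coeff_ext (f : C -> C) (a b : nat -> C) :
  (forall n, a n = b n) -> expands f a -> expands f b.
Proof.
apply expands_ext; exists (mkposreal 1 Rlt_0_1); reflexivity.
Qed.

(** Abel's argument: convergence at d / 2 bounds the terms there, so at d / 4 they are dominated by
    a geometric series of ratio 1/2. *)
Lemma expands_of_series (f : C -> C) (a : nat -> C) :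
  locally (0 : C) (fun z => Cseries (fun n => a n * z ^ n) (f z)) -> expands f a.
Proof.
rewrite locally_Cmod; intros [d [Hd H]].
assert (Hb : exists M : R, forall n, (Cmod (a n * RtoC (d / 2) ^ n) <= M)%R).
{ assert (Hz : Cseries (fun n => a n * RtoC (d / 2) ^ n) (f (RtoC (d / 2)))).
  { apply H; replace (RtoC (d / 2) - 0) with (RtoC (d / 2)) by ring.
    rewrite Cmod_R, Rabs_pos_eq; lra. }
  apply Cseries_components in Hz; destruct Hz as [Hz1 Hz2].
  assert (Hbound : forall (x : nat -> R) (l : R), is_series x l ->
    exists M : R, forall n, (Rabs (x n) <= M)%R).
  { intros x l Hx.
    assert (Hx0 := ex_series_lim_0 x (ex_intro _ l Hx)).
    destruct (filterlim_bounded x) as [M HM]; [exists (0%R : R_NormedModule); exact Hx0|].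
    exists M; exact HM. }
  destruct (Hbound _ _ Hz1) as [M1 HM1], (Hbound _ _ Hz2) as [M2 HM2].
  exists (M1 + M2)%R; intros n; specialize (HM1 n); specialize (HM2 n).
  set (w := a n * RtoC (d / 2) ^ n) in *.
  replace w with (RtoC (Re w) + Ci * RtoC (Im w))
    by (apply injective_projections; simpl; unfold Re, Im; ring).
  eapply Rle_trans; [apply Cmod_triangle|].
  rewrite Cmod_mult, Cmod_Ci, !Cmod_R, Rmult_1_l; lra. }
destruct Hb as [M HM].
exists (d / 4)%R; split; [lra|]; split.
- apply ex_series_dominated with (fun n => M * (/ 2) ^ n)%R.
  + intros n; split.
    { apply Rmult_le_pos; [apply Cmod_ge_0|apply pow_le; lra]. }
    specialize (HM n); rewrite Cmod_term, Cmod_R, Rabs_pos_eq in HM by lra.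
    replace (d / 4)%R with (d / 2 * / 2)%R by field.
    rewrite Rpow_mult_distr, <- Rmult_assoc.
    apply Rmult_le_compat_r; [apply pow_le; lra|exact HM].
  + apply (ex_series_scal (K := R_AbsRing) (V := R_NormedModule)).
    apply ex_series_geom; rewrite Rabs_pos_eq; lra.
- intros z Hz; apply H; replace (z - 0) with z by ring; lra.
Qed.

Lemma expands_plus (f g : C -> C) (a b : nat -> C) :
  expands f a -> expands g b ->
  expands (fun z => f z + g z) (fun n => a n + b n).
Proof.
intros Hf Hg; destruct (expands_common f g a b Hf Hg) as [r [Hr [Ha [Hb H]]]].
exists r; repeat split; [assumption| |].
- apply ex_series_dominated with (fun n => Cmod (a n) * r ^ n + Cmod (b n) * r ^ n)%R.
  + intros n; assert (0 <= r ^ n)%R by (apply pow_le; lra); split.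
    * apply Rmult_le_pos; [apply Cmod_ge_0|assumption].
    * rewrite <- Rmult_plus_distr_r; apply Rmult_le_compat_r; [assumption|].
      apply Cmod_triangle.
  + apply (ex_series_plus (V := R_NormedModule)); assumption.
- intros z Hz; destruct (H z Hz) as [H1 H2].
  eapply Cseries_ext; [|exact (is_series_plus _ _ _ _ H1 H2)].
  intros n; unfold plus; simpl; ring.
Qed.

Lemma expands_scal (k : C) (f : C -> C) (a : nat -> C) :
  expands f a -> expands (fun z => k * f z) (fun n => k * a n).
Proof.
intros [r [Hr [Ha Hf]]]; exists r; repeat split; [assumption| |].
- eapply ex_series_ext;
    [|exact (ex_series_scal (K := R_AbsRing) (V := R_NormedModule) (Cmod k) _ Ha)].
  intros n; rewrite Cmod_mult; unfold scal; simpl; unfold mult; simpl; ring.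
- intros z Hz.
  eapply Cseries_ext; [|exact (is_series_scal k _ _ (Hf z Hz))].
  intros n; unfold scal; simpl; unfold mult; simpl; ring.
Qed.

Lemma expands_minus (f g : C -> C) (a b : nat -> C) :
  expands f a -> expands g b ->
  expands (fun z => f z - g z) (fun n => a n - b n).
Proof.
intros Hf Hg; apply (expands_scal (-(1))) in Hg.
eapply expands_ext; [| |exact (expands_plus _ _ _ _ Hf Hg)].
- apply filter_forall; intros z; simpl; ring.
- intros n; simpl; ring.
Qed.

Lemma conv_scale (a b : nat -> C) (z : C) (n : nat) :
  conv a b n * z ^ n = conv (fun k => a k * z ^ k) (fun k => b k * z ^ k) n.
Proof.
unfold conv.
rewrite Cmult_comm, <- (sum_n_mult_l (K := C_Ring)).
apply sum_n_ext_loc; intros k Hk; unfold mult; simpl.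
replace (z ^ n) with (z ^ k * z ^ (n - k)) by (rewrite <- Cpow_add_r; f_equal; lia).
ring.
Qed.

Lemma expands_mult (f g : C -> C) (a b : nat -> C) :
  expands f a -> expands g b ->
  expands (fun z => f z * g z) (conv a b).
Proof.
intros Hf Hg; destruct (expands_common f g a b Hf Hg) as [r [Hr [Ha [Hb H]]]].
exists r; repeat split; [assumption| |].
- set (a' := fun n => (Cmod (a n) * r ^ n)%R) in *.
  set (b' := fun n => (Cmod (b n) * r ^ n)%R) in *.
  assert (Hpos : forall c n, (0 <= Cmod c * r ^ n)%R)
    by (intros; apply Rmult_le_pos; [apply Cmod_ge_0|apply pow_le; lra]).
  destruct Ha as [la Hla], Hb as [lb Hlb].
  apply ex_series_dominated with
    (fun n => sum_f_R0 (fun k => a' k * b' (n - k)%nat)%R n).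
  + intros n; split; [apply Hpos|].
    replace (Cmod (conv a b n) * r ^ n)%R with (Cmod (conv a b n * RtoC r ^ n))
      by (rewrite Cmod_term, Cmod_R, Rabs_pos_eq by lra; reflexivity).
    rewrite conv_scale; eapply Rle_trans; [apply Cmod_sum_n|].
    rewrite sum_n_Reals; apply Req_le, sum_eq; intros k _.
    rewrite Cmod_mult, !Cmod_term, Cmod_R, Rabs_pos_eq by lra; reflexivity.
  + exists (la * lb)%R; apply is_series_mult; [assumption..| |].
    * exists la; eapply is_series_ext; [|exact Hla].
      intros n; rewrite Rabs_pos_eq; [reflexivity|apply Hpos].
    * exists lb; eapply is_series_ext; [|exact Hlb].
      intros n; rewrite Rabs_pos_eq; [reflexivity|apply Hpos].
- intros z Hz; destruct (H z Hz) as [H1 H2].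
  eapply Cseries_ext; [intros n; symmetry; apply conv_scale|].
  pose proof (Cmod_ge_0 z).
  apply Cseries_mult; [assumption..| |].
  + eapply ex_series_ext; [intros n; symmetry; apply Cmod_term|].
    apply ex_series_shrink with r; [lra|assumption].
  + eapply ex_series_ext; [intros n; symmetry; apply Cmod_term|].
    apply ex_series_shrink with r; [lra|assumption].
Qed.

Definition shift (a : nat -> C) (n : nat) : C :=
  match n with 0%nat => 0 | S m => a m end.

Lemma expands_shift (f : C -> C) (a : nat -> C) :
  expands f a -> expands (fun z => z * f z) (shift a).
Proof.
intros [r [Hr [Ha Hf]]]; exists r; repeat split; [assumption| |].
- apply ex_series_incr_1.
  eapply ex_series_ext;
    [|exact (ex_series_scal (K := R_AbsRing) (V := R_NormedModule) r _ Ha)].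
  intros n; unfold scal; simpl; unfold mult; simpl; ring.
- intros z Hz; apply (is_series_decr_1 (V := C_NormedModule)).
  eapply (is_series_ext (V := C_NormedModule)).
  2: { replace (plus (z * f z : C_NormedModule) _) with (scal z (f z : C_NormedModule)).
    - exact (is_series_scal z _ _ (Hf z Hz)).
    - unfold plus, opp, scal; simpl; unfold mult; simpl; ring. }
  intros n; unfold scal; simpl; unfold mult; simpl; ring.
Qed.

Definition Csum (x : nat -> C) : C :=
  (Series (fun n => Re (x n)), Series (fun n => Im (x n))).

Lemma Csum_correct (x : nat -> C) :
  ex_series (fun n => Cmod (x n)) -> Cseries x (Csum x).
Proof.
intros H; apply Cseries_components; split; apply Series_correct, ex_series_Rabs;
  revert H; apply ex_series_dominated; intros n; split;
  try apply Rabs_pos.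
- apply re_le_Cmod.
- eapply Rle_trans, Rmax_Cmod; apply Rmax_r.
Qed.

Lemma Csum_expands (a : nat -> C) (r : R) :
  (0 < r)%R -> ex_series (fun n => Cmod (a n) * r ^ n)%R ->
  expands (fun z => Csum (fun n => a n * z ^ n)) a.
Proof.
intros Hr Ha; exists r; repeat split; [assumption|assumption|].
intros z Hz; apply Csum_correct.
eapply ex_series_ext; [intros n; symmetry; apply Cmod_term|].
pose proof (Cmod_ge_0 z); apply ex_series_shrink with r; [lra|assumption].
Qed.

(** * Termwise differentiation of power series *)

Lemma INR_le_pow2 (n : nat) : (INR n <= 2 ^ n)%R.
Proof.
induction n as [|n IH]; [simpl; lra|].
rewrite S_INR; simpl; assert (1 <= 2 ^ n)%R by (apply pow_R1_Rle; lra); lra.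
Qed.

Definition deriv (a : nat -> C) (n : nat) : C := INR (S n) * a (S n).

(** Halving the radius gains a factor 2^n, which absorbs the factor brought down by
    differentiation. *)
Lemma ex_series_deriv (a : nat -> C) (r : R) :
  (0 < r)%R -> ex_series (fun n => Cmod (a n) * r ^ n)%R ->
  ex_series (fun n => Cmod (deriv a n) * (r / 2) ^ n)%R.
Proof.
intros Hr Ha; apply ex_series_incr_1 in Ha.
apply (ex_series_scal (K := R_AbsRing) (V := R_NormedModule) (2 / r)%R) in Ha.
revert Ha; apply ex_series_dominated; intros n; split.
- apply Rmult_le_pos; [apply Cmod_ge_0|apply pow_le; lra].
- unfold deriv; rewrite Cmod_mult, Cmod_R, Rabs_pos_eq by apply pos_INR.
  unfold scal; simpl; unfold mult; simpl.
  replace (r ^ n)%R with (2 ^ n * (r / 2) ^ n)%R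
    by (rewrite <- Rpow_mult_distr; f_equal; field).
  replace (2 / r * (Cmod (a (S n)) * (r * (2 ^ n * (r / 2) ^ n))))%R with
    (2 ^ (S n) * (Cmod (a (S n)) * (r / 2) ^ n))%R by (simpl; field; lra).
  rewrite Rmult_assoc; apply Rmult_le_compat_r; [|exact (INR_le_pow2 (S n))].
  apply Rmult_le_pos; [apply Cmod_ge_0|apply pow_le; lra].
Qed.

(** The factor [q ^ 2] on the left clears the exponent n - 2 of the usual bound n^2 q^(n-2), so that
    n = 0 and n = 1 need no separate form. If R_n denotes the remainder, then R_(n+1) = w R_n + n
    z^(n-1) (w - z)^2, and n^2 + n <= (n + 1)^2 closes the induction. *)
Lemma pow_taylor_bound (z w : C) (q : R) (n : nat) :
  (Cmod z <= q)%R -> (Cmod w <= q)%R ->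
  (q ^ 2 * Cmod (w ^ n - z ^ n - (w - z) * (INR n * z ^ pred n))
   <= Cmod (w - z) ^ 2 * (INR n ^ 2 * q ^ n))%R.
Proof.
intros Hz Hw; pose proof (Cmod_ge_0 z) as Hz0; pose proof (Cmod_ge_0 w) as Hw0.
induction n as [|n IH].
- simpl; replace (1 - 1 - (w - z) * (0 * 1)) with (RtoC 0) by ring.
  rewrite Cmod_0; lra.
- replace (w ^ S n - z ^ S n - (w - z) * (INR (S n) * z ^ pred (S n))) with
    (w * (w ^ n - z ^ n - (w - z) * (INR n * z ^ pred n))
     + (w - z) ^ 2 * (INR n * z ^ pred n)).
  2: { rewrite S_INR, RtoC_plus; destruct n; simpl; ring. }
  set (e := w ^ n - z ^ n - (w - z) * (INR n * z ^ pred n)) in *.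
  assert (Hn : (INR n * Cmod z ^ pred n * q <= INR n * q ^ n)%R).
  { destruct n as [|n]; [simpl; lra|].
    simpl pred; rewrite Rmult_assoc; apply Rmult_le_compat_l; [apply pos_INR|].
    simpl; rewrite Rmult_comm; apply Rmult_le_compat_l; [lra|].
    apply pow_incr; lra. }
  apply Rle_trans with
    (q ^ 2 * (Cmod w * Cmod e + Cmod (w - z) ^ 2 * (INR n * Cmod z ^ pred n)))%R.
  { apply Rmult_le_compat_l; [nra|].
    eapply Rle_trans; [apply Cmod_triangle|].
    rewrite !Cmod_mult, !Cmod_pow, Cmod_R, Rabs_pos_eq by apply pos_INR; lra. }
  pose proof (Cmod_ge_0 e) as He; pose proof (pow2_ge_0 (Cmod (w - z))) as Hh.
  assert (H1 : (q ^ 2 * (Cmod w * Cmod e) <= q * (Cmod (w - z) ^ 2 * (INR n ^ 2 * q ^ n)))%R).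
  { apply Rle_trans with (q * (q ^ 2 * Cmod e))%R; [|apply Rmult_le_compat_l; lra].
    replace (q ^ 2 * (Cmod w * Cmod e))%R with (Cmod w * (q ^ 2 * Cmod e))%R by ring.
    apply Rmult_le_compat_r; [nra|lra]. }
  assert (H2 : (q ^ 2 * (Cmod (w - z) ^ 2 * (INR n * Cmod z ^ pred n))
      <= q * (Cmod (w - z) ^ 2 * (INR n * q ^ n)))%R).
  { replace (q ^ 2 * (Cmod (w - z) ^ 2 * (INR n * Cmod z ^ pred n)))%R with
      (q * (Cmod (w - z) ^ 2 * (INR n * Cmod z ^ pred n * q)))%R by ring.
    apply Rmult_le_compat_l; [lra|]; apply Rmult_le_compat_l; assumption. }
  rewrite S_INR, Rmult_plus_distr_l; simpl (q ^ S n)%R.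
  assert (H3 : (0 <= q * (Cmod (w - z) ^ 2 * q ^ n) * (INR n + 1))%R).
  { pose proof (pos_INR n); apply Rmult_le_pos; [|lra]; apply Rmult_le_pos; [lra|].
    apply Rmult_le_pos; [assumption|apply pow_le; lra]. }
  nra.
Qed.

Lemma expands_derive (f : C -> C) (a : nat -> C) :
  expands f a ->
  expands (C_derive f) (deriv a) /\
  locally (0 : C) (fun z => Cderives f z (C_derive f z)).
Proof.
intros [r [Hr [Ha Hf]]].
set (g := fun z => Csum (fun n => deriv a n * z ^ n)).
assert (Hd := ex_series_deriv a r Hr Ha).
assert (Hg : expands g (deriv a)) by (apply Csum_expands with (r / 2)%R; [lra|exact Hd]).
(* With this choice n^2 q^n <= (2^n)^2 q^n = r^n, so summing the remainders of the powers bounds the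
   remainder of [f] by [Cmod (w - z) ^ 2] times A / q^2, where A is the sum of the
   [Cmod (a n) * r ^ n]. *)
set (q := (r / 4)%R).
assert (Hq : (0 < q)%R) by (unfold q; lra).
assert (Hder : forall z, (Cmod z < q)%R -> Cderives f z (g z)).
{ intros z Hz; pose proof (Cmod_ge_0 z) as Hz0.
  assert (Hgz : Cseries (fun n => a n * (INR n * z ^ pred n)) (g z)).
  { apply (is_series_decr_1 (V := C_NormedModule)).
    replace (plus (g z : C_NormedModule) _) with (g z)
      by (unfold plus, opp; simpl; ring).
    apply Cseries_ext with (fun n => deriv a n * z ^ n).
    { intros n; unfold deriv; simpl pred; ring. }
    apply Csum_correct; eapply ex_series_ext; [intros n; symmetry; apply Cmod_term|].
    apply ex_series_shrink with (r / 2)%R; [unfold q in Hz; lra|exact Hd]. }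
  destruct Ha as [A HA].
  assert (HA0 : (0 <= A)%R).
  { apply Rle_trans with (Cmod (f z)); [apply Cmod_ge_0|].
    apply (Cseries_Cmod_le _ _ _ _ (Hf z ltac:(unfold q in *; lra)) HA).
    intros n; rewrite Cmod_term; apply Rmult_le_compat_l; [apply Cmod_ge_0|].
    apply pow_incr; unfold q in *; lra. }
  assert (Hquad : forall w, (Cmod w < q)%R ->
    (q ^ 2 * Cmod (f w - f z - (w - z) * g z) <= Cmod (w - z) ^ 2 * A)%R).
  { intros w Hw; pose proof (Cmod_ge_0 w) as Hw0.
    rewrite <- (Rabs_pos_eq (q ^ 2)), <- Cmod_R, <- Cmod_mult by nra.
    assert (Hser : Cseries (fun n => RtoC (q ^ 2) *
       (a n * w ^ n - a n * z ^ n - (w - z) * (a n * (INR n * z ^ pred n))))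
       (RtoC (q ^ 2) * (f w - f z - (w - z) * g z))).
    { apply (is_series_scal (V := C_NormedModule) (RtoC (q ^ 2))).
      apply (is_series_minus (V := C_NormedModule)).
      - apply (is_series_minus (V := C_NormedModule)); apply Hf; unfold q in *; lra.
      - apply (is_series_scal (V := C_NormedModule) (w - z)); exact Hgz. }
    apply (Cseries_Cmod_le _ _ _ _ Hser
      (is_series_scal (V := R_NormedModule) (Cmod (w - z) ^ 2)%R _ _ HA)).
    intros n; unfold scal; simpl; unfold mult; simpl.
    replace (a n * w ^ n - a n * z ^ n - (w - z) * (a n * (INR n * z ^ pred n))) with
      (a n * (w ^ n - z ^ n - (w - z) * (INR n * z ^ pred n))) by ring.
    rewrite !Cmod_mult, Cmod_R, Rabs_pos_eq by nra.
    pose proof (pow_taylor_bound z w q n (Rlt_le _ _ Hz) (Rlt_le _ _ Hw)) as Hb.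
    assert (HN : (INR n ^ 2 * q ^ n <= r ^ n)%R).
    { replace (r ^ n)%R with ((2 ^ n) ^ 2 * q ^ n)%R
        by (unfold q; rewrite <- pow_mult, Nat.mul_comm, pow_mult, <- Rpow_mult_distr;
            f_equal; field).
      apply Rmult_le_compat_r; [apply pow_le; lra|].
      apply pow_incr; split; [apply pos_INR|apply INR_le_pow2]. }
    pose proof (Cmod_ge_0 (a n)) as Han; pose proof (pow2_ge_0 (Cmod (w - z))) as Hh.
    set (e := Cmod (w ^ n - z ^ n - (w - z) * (INR n * z ^ pred n))) in *.
    assert (H1 : (q ^ 2 * e <= Cmod (w - z) ^ 2 * r ^ n)%R).
    { eapply Rle_trans; [exact Hb|]; apply Rmult_le_compat_l; assumption. }
    apply (Rmult_le_compat_l (Cmod (a n))) in H1; [|exact Han].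
    simpl in *; lra. }
  apply Cderives_eps; intros eps He.
  assert (Hd0 : (0 < eps * q ^ 2 / (1 + A))%R).
  { apply Rdiv_lt_0_compat; [|lra]; apply Rmult_lt_0_compat; [lra|apply pow_lt; lra]. }
  exists (Rmin (q - Cmod z) (eps * q ^ 2 / (1 + A))); split.
  { apply Rmin_pos; [lra|exact Hd0]. }
  intros w Hw.
  assert (H1 := Rlt_le_trans _ _ _ Hw (Rmin_l _ _)).
  assert (H2 := Rlt_le_trans _ _ _ Hw (Rmin_r _ _)).
  assert (Hwq : (Cmod w < q)%R).
  { replace w with (w - z + z) by ring.
    eapply Rle_lt_trans; [apply Cmod_triangle|lra]. }
  specialize (Hquad w Hwq).
  apply Rlt_le, Rle_div_r in H2; [|lra].
  pose proof (Cmod_ge_0 (w - z)) as Hh.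
  apply Rmult_le_reg_l with (q ^ 2)%R; [apply pow_lt; lra|].
  nra. }
assert (Hloc : locally (0 : C) (fun z => Cderives f z (g z))).
{ apply locally_Cmod; exists q; split; [exact Hq|]; intros w Hw; apply Hder.
  replace w with (w - 0) by ring; exact Hw. }
split.
- apply (expands_ext g _ (deriv a)); [|reflexivity|exact Hg].
  revert Hloc; apply filter_imp; intros z Hz; symmetry; apply is_C_derive_unique, Hz.
- revert Hloc; apply filter_imp; intros z Hz.
  rewrite (is_C_derive_unique _ _ _ Hz); exact Hz.
Qed.

(** * Identity theorem for power series at the origin *)

Lemma Cseries_at_0 (a : nat -> C) : Cseries (fun n => a n * 0 ^ n) (a 0%nat).
Proof.
apply (is_series_decr_1 (V := C_NormedModule)).
apply (is_series_ext (V := C_NormedModule) (fun _ => zero)).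
{ intros n; unfold zero; simpl; ring. }
replace (plus (a 0%nat : C_NormedModule) _) with (zero : C_NormedModule)
  by (unfold plus, opp, zero; simpl; ring).
apply filterlim_ext with (fun _ => zero : C_NormedModule).
{ intros n; induction n as [|n IH]; [rewrite sum_O; reflexivity|].
  rewrite sum_Sn, <- IH, plus_zero_l; reflexivity. }
apply filterlim_const.
Qed.

Lemma expands_at_0 (f : C -> C) (a : nat -> C) : expands f a -> f 0 = a 0%nat.
Proof.
intros [r [Hr [_ Hf]]].
apply Cseries_unique with (fun n => a n * 0 ^ n).
- apply Hf; rewrite Cmod_0; exact Hr.
- apply Cseries_at_0.
Qed.

Lemma expands_unshift (f : C -> C) (a : nat -> C) :
  expands f a -> a 0%nat = 0 ->
  expands (fun z => Csum (fun n => a (S n) * z ^ n)) (fun n => a (S n)) /\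
  locally (0 : C) (fun z => f z = z * Csum (fun n => a (S n) * z ^ n)).
Proof.
intros Hf Ha0.
assert (Hu : expands (fun z => Csum (fun n => a (S n) * z ^ n)) (fun n => a (S n))).
{ destruct Hf as [r [Hr [Ha _]]]; apply Csum_expands with r; [exact Hr|].
  apply ex_series_incr_1 in Ha.
  apply (ex_series_scal (K := R_AbsRing) (V := R_NormedModule) (/ r)%R) in Ha.
  revert Ha; apply ex_series_ext; intros n.
  unfold scal; simpl; unfold mult; simpl; field; lra. }
split; [exact Hu|].
destruct (expands_common _ _ _ _ Hf (expands_shift _ _ Hu)) as [r [Hr [_ [_ H]]]].
apply locally_Cmod; exists r; split; [exact Hr|].
intros z Hz; replace (z - 0) with z in Hz by ring.
destruct (H z Hz) as [H1 H2]; apply (Cseries_unique _ _ _ H1).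
eapply Cseries_ext; [|exact H2]; intros [|n]; simpl; [rewrite Ha0|]; reflexivity.
Qed.

Lemma continuous_punctured_zero (f : C -> C) (l : C) :
  Cderives f 0 l -> locally' (0 : C) (fun z => f z = 0) -> f 0 = 0.
Proof.
intros Hf H0; apply Cmod_eq_0.
destruct (Rle_lt_or_eq_dec _ _ (Cmod_ge_0 (f 0))) as [Hp|Hp]; [exfalso|auto].
assert (Hc := Cderives_continuous f 0 l Hf _ Hp).
apply locally'_Cmod in H0; destruct H0 as [d1 [Hd1 H1]].
apply locally_Cmod in Hc; destruct Hc as [d2 [Hd2 H2]].
assert (Hd : (0 < Rmin d1 d2)%R) by (apply Rmin_pos; assumption).
pose proof (Rmin_l d1 d2); pose proof (Rmin_r d1 d2).
set (w := RtoC (Rmin d1 d2 / 2)).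
assert (Hw : Cmod (w - 0) = (Rmin d1 d2 / 2)%R).
{ replace (w - 0) with w by ring; unfold w; rewrite Cmod_R, Rabs_pos_eq; lra. }
assert (Hw0 : w <> 0).
{ unfold w; intros E; apply RtoC_inj in E; lra. }
specialize (H1 w ltac:(lra) Hw0); specialize (H2 w ltac:(lra)).
rewrite H1 in H2; replace (0 - f 0) with (- f 0) in H2 by ring.
rewrite Cmod_opp in H2; lra.
Qed.

(** Continuity gives [a 0 = 0], and dividing by [z] moves the next coefficient to index 0; hence the
    induction ranges over all [f] and [a]. The hypothesis is punctured because formulas with tau in
    the denominator say nothing at 0. *)
Lemma expands_zero (f : C -> C) (a : nat -> C) :
  expands f a -> locally' (0 : C) (fun z => f z = 0) -> forall n, a n = 0.
Proof.
intros Hf H0 n; revert f a Hf H0; induction n as [|n IH]; intros f a Hf H0;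
destruct (expands_derive f a Hf) as [_ Hder];
assert (Ha0 := continuous_punctured_zero f _ (locally_singleton _ _ Hder) H0);
rewrite (expands_at_0 f a Hf) in Ha0; [exact Ha0|].
destruct (expands_unshift f a Hf Ha0) as [Hu Hfu].
apply (IH _ (fun n => a (S n)) Hu).
unfold locally', within in *; generalize (filter_and _ _ H0 Hfu).
apply filter_imp; intros z [H1 H2] Hz.
specialize (H1 Hz); rewrite H2 in H1.
set (s := Csum _) in *.
replace s with (/ z * (z * s)) by (field; exact Hz); rewrite H1; ring.
Qed.

Lemma expands_unique (f g : C -> C) (a b : nat -> C) :
  expands f a -> expands g b -> locally' (0 : C) (fun z => f z = g z) ->
  forall n, a n = b n.
Proof.
intros Hf Hg H n.
assert (E : a n - b n = 0).
{ apply (expands_zero _ _ (expands_minus f g a b Hf Hg)).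
  unfold locally', within in *; revert H; apply filter_imp; intros z Hz Hz0.
  rewrite Hz by exact Hz0; ring. }
replace (a n) with (a n - b n + b n) by ring; rewrite E; ring.
Qed.

(** * The bilinear equation *)

(** A complex derivative is determined by its restriction to a horizontal line. There real calculus
    applies, which suits [Cexp], defined through real [exp], [cos] and [sin]. *)
Lemma Cderives_horizontal (f : C -> C) (x y : R) (l : C) :
  Cderives f (x, y) l ->
  is_derive (fun t : R => Re (f (t, y))) x (Re l) /\
  is_derive (fun t : R => Im (f (t, y))) x (Im l).
Proof.
rewrite Cderives_eps; intros H.
assert (Hh : forall eps : posreal, exists d : R, (0 < d)%R /\ forall t : R,
  (Rabs (t - x) < d)%R ->
  (Cmod (f (t, y) - f (x, y) - RtoC (t - x) * l) <= eps * Rabs (t - x))%R).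
{ intros eps; destruct (H eps (cond_pos eps)) as [d [Hd Hd']].
  exists d; split; [exact Hd|]; intros t Ht.
  assert (E : (t, y) - (x, y) = RtoC (t - x))
    by (apply injective_projections; simpl; ring).
  rewrite <- Cmod_R, <- E; apply Hd'; rewrite E, Cmod_R; exact Ht. }
split; (split; [apply is_linear_scal_l|]; intros x' Hx eps;
  rewrite <- (is_filter_lim_locally_unique _ _ Hx);
  destruct (Hh eps) as [d [Hd Hd']]; exists (mkposreal d Hd); intros t Ht;
  specialize (Hd' t Ht)).
- refine (Rle_trans _ _ _ _ Hd'); eapply Rle_trans; [|apply re_le_Cmod].
  apply Req_le; unfold norm, minus, scal, plus, opp; simpl; unfold abs, mult; simpl.
  f_equal; unfold Re; ring.
- refine (Rle_trans _ _ _ _ Hd').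
  eapply Rle_trans; [|eapply Rle_trans; [apply Rmax_r|apply Rmax_Cmod]].
  apply Req_le; unfold norm, minus, scal, plus, opp; simpl; unfold abs, mult; simpl.
  f_equal; unfold Im; ring.
Qed.

(** Both complex derivatives exist by hypothesis, so it is enough to compare them along the
    horizontal direction; complex differentiability of [Cexp] never enters. *)
Lemma Cderives_log (L f : C -> C) (z l t : C) :
  Cderives L z l -> Cderives f z t -> locally z (fun w => Cexp (L w) = f w) ->
  t = l * f z.
Proof.
destruct z as [x y]; intros HL Hf Hexp.
rewrite <- (locally_singleton _ _ Hexp).
apply (Cderives_ext f (fun w => Cexp (L w))) in Hf;
  [|revert Hexp; apply filter_imp; auto].
apply Cderives_horizontal in HL; apply Cderives_horizontal in Hf.
destruct HL as [HL1 HL2], Hf as [Hf1 Hf2].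
set (p := fun t : R => Re (L (t, y))) in *.
set (q := fun t : R => Im (L (t, y))) in *.
assert (Hp := is_derive_unique _ _ _ HL1); assert (Hq := is_derive_unique _ _ _ HL2).
assert (H1 : is_derive (fun s => exp (p s) * cos (q s))%R x
  (exp (p x) * (Re l * cos (q x) - Im l * sin (q x)))%R).
{ auto_derive; [split; [|split]; try exact I; eexists; eassumption|].
  change (fun x0 => p x0) with p; change (fun x0 => q x0) with q.
  rewrite Hp, Hq; ring. }
assert (H2 : is_derive (fun s => exp (p s) * sin (q s))%R x
  (exp (p x) * (Re l * sin (q x) + Im l * cos (q x)))%R).
{ auto_derive; [split; [|split]; try exact I; eexists; eassumption|].
  change (fun x0 => p x0) with p; change (fun x0 => q x0) with q.
  rewrite Hp, Hq; ring. }
apply is_derive_unique in H1; apply is_derive_unique in H2.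
apply is_derive_unique in Hf1; apply is_derive_unique in Hf2.
apply injective_projections.
- change (Re t = Re (l * Cexp (L (x, y)))).
  rewrite <- Hf1; etransitivity; [exact H1|].
  unfold p, q, Cexp; simpl; unfold Re, Im; ring.
- change (Im t = Im (l * Cexp (L (x, y)))).
  rewrite <- Hf2; etransitivity; [exact H2|].
  unfold p, q, Cexp; simpl; unfold Re, Im; ring.
Qed.

(** Any branch [L] has L' = tau' / tau near [z], and the quotient rule gives L''. The second
    derivative of tau is an argument because [tau_function] provides a first derivative only; near 0
    the Taylor series supplies it. *)
Lemma tau_function_formula (u tau : C -> C) (z t2 : C) :
  tau_function u tau -> tau z <> 0 -> Cderives (C_derive tau) z t2 ->
  u z = (C_derive tau z ^ 2 - tau z * t2) / tau z ^ 2.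
Proof.
intros [Hent [_ Hlog]] Hz H2.
assert (H1 : forall w, Cderives tau w (C_derive tau w))
  by (intros w; apply C_derive_correct; [exact w|apply Hent]).
destruct (Hlog z Hz) as [L [HL [Hexp ->]]].
assert (HL' : locally z (fun w => C_derive L w = C_derive tau w / tau w)).
{ generalize (filter_and _ _ (holomorphic_Cderives _ _ HL)
    (filter_and _ _ (locally_locally _ _ Hexp) (Cderives_neq0 _ _ _ (H1 z) Hz))).
  apply filter_imp; intros w [HLw [Hw Hnz]].
  rewrite (Cderives_log L tau w _ _ HLw (H1 w) Hw); field; exact Hnz. }
rewrite (C_derive_ext _ _ _ _ HL' (Cderives_div _ _ _ _ _ H2 (H1 z) Hz)).
field; exact Hz.
Qed.

Ltac Cderives_tac :=
  lazymatch goal with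
  | |- is_derive (fun _ => ?k) _ _ => exact (Cderives_const k _)
  | |- is_derive (fun w => w) _ _ => exact (Cderives_id _)
  | |- is_derive (fun w => @?f w + @?g w) _ _ =>
      eapply (Cderives_plus f g); Cderives_tac
  | |- is_derive (fun w => @?f w - @?g w) _ _ =>
      eapply (Cderives_minus f g); Cderives_tac
  | |- is_derive (fun w => @?f w * @?g w) _ _ =>
      eapply (Cderives_mult f g); Cderives_tac
  | |- is_derive (fun w => @?f w ^ ?n) _ _ =>
      eapply (Cderives_pow f); Cderives_tac
  | |- is_derive _ _ _ => cbv beta; eassumption
  end.

(** For u = - (log T0)'' one has identically u'' = 6 u^2 - H / T0^2, with H the left-hand side of
    the conclusion, so the quadratic terms of the Painleve equation cancel. The formula for [u] is
    required on a neighbourhood, since [u] is differentiated twice and has to be shown holomorphic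
    at [z]. *)
Lemma painleve1_bilinear (g2 lam z : C) (u T0 T1 T2 T3 T4 : C -> C) :
  locally z (fun w => Cderives T0 w (T1 w) /\ Cderives T1 w (T2 w) /\
    Cderives T2 w (T3 w) /\ Cderives T3 w (T4 w) /\ T0 w <> 0 /\
    u w = (T1 w ^ 2 - T0 w * T2 w) / T0 w ^ 2) ->
  (holomorphic_at u z ->
   C_derive (C_derive u) z = 6 * u z ^ 2 - 6 * lam * z - g2 / 2) ->
  T0 z * T4 z - 4 * T1 z * T3 z + 3 * T2 z ^ 2 = (6 * lam * z + g2 / 2) * T0 z ^ 2.
Proof.
intros Hloc Hode.
assert (Hu : locally z (fun w => Cderives u w
  ((3 * T0 w * T1 w * T2 w - 2 * T1 w ^ 3 - T0 w ^ 2 * T3 w) / T0 w ^ 3))).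
{ generalize (filter_and _ _ (locally_locally _ _ Hloc) Hloc).
  apply filter_imp; intros w [Hw [H0 [H1 [H2 [H3 [Hnz _]]]]]].
  apply (Cderives_ext (fun w => (T1 w ^ 2 - T0 w * T2 w) / T0 w ^ 2)).
  { revert Hw; apply filter_imp; intros v Hv; symmetry; apply Hv. }
  assert (Hnz2 : T0 w ^ 2 <> 0) by (apply Cpow_nz; exact Hnz).
  (* The existential lets the differentiation rules produce a derivative in whatever shape they
     give; [field] then identifies it with the intended one. *)
  assert (HD : exists l, Cderives (fun w => (T1 w ^ 2 - T0 w * T2 w) / T0 w ^ 2) w l /\
    l = (3 * T0 w * T1 w * T2 w - 2 * T1 w ^ 3 - T0 w ^ 2 * T3 w) / T0 w ^ 3).
  { eexists; split.
    { eapply (Cderives_div (fun w => T1 w ^ 2 - T0 w * T2 w) (fun w => T0 w ^ 2));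
        [Cderives_tac..|exact Hnz2]. }
    simpl; rewrite ?RtoC_plus; field; exact Hnz. }
  destruct HD as [l [HD <-]]; exact HD. }
specialize (Hode (Cderives_holomorphic _ _ _ Hu)).
destruct (locally_singleton _ _ Hloc) as [H0 [H1 [H2 [H3 [Hnz Huz]]]]].
assert (Hnz3 : T0 z ^ 3 <> 0) by (apply Cpow_nz; exact Hnz).
assert (HC : locally z (fun w => C_derive u w =
  (3 * T0 w * T1 w * T2 w - 2 * T1 w ^ 3 - T0 w ^ 2 * T3 w) / T0 w ^ 3)).
{ revert Hu; apply filter_imp; intros w Hw; apply is_C_derive_unique, Hw. }
assert (HD : exists l, Cderives (fun w =>
    (3 * T0 w * T1 w * T2 w - 2 * T1 w ^ 3 - T0 w ^ 2 * T3 w) / T0 w ^ 3) z l /\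
  l = 6 * ((T1 z ^ 2 - T0 z * T2 z) / T0 z ^ 2) ^ 2
      - (T0 z * T4 z - 4 * T1 z * T3 z + 3 * T2 z ^ 2) / T0 z ^ 2).
{ eexists; split.
  { eapply (Cderives_div
      (fun w => 3 * T0 w * T1 w * T2 w - 2 * T1 w ^ 3 - T0 w ^ 2 * T3 w)
      (fun w => T0 w ^ 3)); [Cderives_tac..|exact Hnz3]. }
  simpl; rewrite ?RtoC_plus; field; exact Hnz. }
destruct HD as [l [HD Hl]].
rewrite (C_derive_ext _ _ _ _ HC HD), Huz, Hl in Hode.
set (H := T0 z * T4 z - 4 * T1 z * T3 z + 3 * T2 z ^ 2) in *.
set (U := 6 * ((T1 z ^ 2 - T0 z * T2 z) / T0 z ^ 2) ^ 2) in *.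
replace H with ((U - (U - H / T0 z ^ 2)) * T0 z ^ 2) by (field; exact Hnz).
rewrite Hode; ring.
Qed.

(** * Finite sums *)

Lemma sum_n_zero (x : nat -> C) (n : nat) :
  (forall k, (k <= n)%nat -> x k = 0) -> (sum_n (G := C_AbelianMonoid) x n : C) = 0.
Proof.
induction n as [|n IH]; intros H.
- rewrite sum_O; apply H; lia.
- rewrite sum_Sn, IH, H by (intros; try apply H; lia); unfold plus; simpl; ring.
Qed.

Lemma sum_n_single (x : nat -> C) (n j : nat) :
  (j <= n)%nat -> (forall k, (k <= n)%nat -> k <> j -> x k = 0) ->
  sum_n (G := C_AbelianMonoid) x n = x j.
Proof.
induction n as [|n IH]; intros Hj H.
- rewrite sum_O; f_equal; lia.
- rewrite sum_Sn; destruct (Nat.eq_dec j (S n)) as [->|Hne].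
  + rewrite sum_n_zero by (intros; apply H; lia); unfold plus; simpl; ring.
  + rewrite IH, (H (S n)) by (intros; try apply H; lia); unfold plus; simpl; ring.
Qed.

(* The coefficient of [z^n] in [g' t - 4 t' g] is [(n - 4) g_n] plus a combination
   of lower coefficients. *)
Lemma conv_deriv_uniqueness (t g : nat -> C) :
  t 0%nat = 0 -> t 1%nat = 1 ->
  (forall n, conv (deriv g) t n = 4 * conv (deriv t) g n) ->
  g 4%nat = 0 -> forall n, g n = 0.
Proof.
intros t0 t1 Heq g4 n; induction n as [n IH] using lt_wf_ind.
destruct (Nat.eq_dec n 4) as [->|Hn4]; [exact g4|].
specialize (Heq n); unfold conv, deriv in Heq.
rewrite (sum_n_single (fun k => INR (S k) * t (S k) * g (n - k)%nat) n 0%nat) in Heq;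
  [|lia|intros k Hk Hk0; rewrite IH by lia; ring].
(* Index [n] is killed by [t 0 = 0], so only [pred n] survives, with the coefficient n of [g n]. For
   n = 0 the two indices coincide, and the remaining term vanishes by [t 0 = 0]. *)
rewrite (sum_n_single _ n (pred n)) in Heq; [|lia|].
- rewrite t1 in Heq; destruct n as [|n].
  + simpl in Heq; rewrite t0 in Heq.
    replace (g 0%nat) with (/ 4 * (4 * (1 * 1 * g 0%nat))).
    * rewrite <- Heq; ring.
    * field; intros E; apply RtoC_inj in E; lra.
  + replace (S n - pred (S n))%nat with 1%nat in Heq by lia.
    rewrite t1 in Heq; simpl pred in Heq; rewrite Nat.sub_0_r in Heq.
    assert (Hne : RtoC (INR (S n)) - 4 <> 0).
    { intros E; assert (E' : RtoC (INR (S n)) = 4)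
        by (replace (RtoC (INR (S n))) with (RtoC (INR (S n)) - 4 + 4) by ring; rewrite E; ring).
      apply RtoC_inj in E'; apply Hn4, INR_eq; rewrite E'; simpl; ring. }
    replace (g (S n)) with
      (/ (INR (S n) - 4) * (INR (S n) * g (S n) * 1 - 4 * (INR 1 * 1 * g (S n)))).
    * rewrite Heq; ring.
    * simpl (INR 1); field; exact Hne.
- intros k Hk Hkn; destruct (Nat.eq_dec k n) as [->|Hk'].
  + rewrite Nat.sub_diag, t0; ring.
  + rewrite (IH (S k)) by lia; ring.
Qed.

(** * Sums over integer ranges and quadruple sums *)

Lemma Zsum_ext (b : Z) (f g : Z -> C) :
  (forall j, (0 <= j <= b)%Z -> f j = g j) -> Zsum b f = Zsum b g.
Proof.
intros H; unfold Zsum.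
rewrite (map_ext_in (fun j => f (Z.of_nat j)) (fun j => g (Z.of_nat j))); [reflexivity|].
intros j Hj; apply in_seq in Hj; apply H; lia.
Qed.

Lemma Zsum_plus (b : Z) (f g : Z -> C) :
  Zsum b (fun j => f j + g j) = Zsum b f + Zsum b g.
Proof.
unfold Zsum; induction (List.seq 0 _) as [|x s IH]; simpl; [ring|rewrite IH; ring].
Qed.

Lemma Zsum_scal (b : Z) (k : C) (f : Z -> C) :
  Zsum b (fun j => k * f j) = k * Zsum b f.
Proof.
unfold Zsum; induction (List.seq 0 _) as [|x s IH]; simpl; [ring|rewrite IH; ring].
Qed.

Lemma Zsum_neg (b : Z) (f : Z -> C) : (b < 0)%Z -> Zsum b f = 0.
Proof.
intros H; unfold Zsum; replace (Z.to_nat (b + 1)) with 0%nat by lia; reflexivity.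
Qed.

Lemma Zsum_0 (b : Z) : Zsum b (fun _ => 0) = 0.
Proof.
unfold Zsum; induction (List.seq 0 _) as [|x s IH]; simpl; [|rewrite IH]; ring.
Qed.

Lemma Zsum_last (b : Z) (f : Z -> C) :
  (0 <= b)%Z -> Zsum b f = Zsum (b - 1) f + f b.
Proof.
intros Hb; unfold Zsum.
replace (Z.to_nat (b + 1)) with (S (Z.to_nat b)) by lia.
replace (Z.to_nat (b - 1 + 1)) with (Z.to_nat b) by lia.
rewrite seq_S, map_app, fold_right_app; simpl; rewrite Z2Nat.id by exact Hb.
generalize (f b); intros y; rewrite Cplus_0_r.
induction (map _ _) as [|x s IH]; simpl; [ring|rewrite IH; ring].
Qed.

Lemma Zsum_sum_n (n : nat) (f : Z -> C) :
  Zsum (Z.of_nat n) f = sum_n (G := C_AbelianMonoid) (fun j => f (Z.of_nat j)) n.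
Proof.
induction n as [|n IH].
- rewrite sum_O; unfold Zsum; simpl; ring.
- rewrite Zsum_last, sum_Sn, <- IH by lia.
  replace (Z.of_nat (S n) - 1)%Z with (Z.of_nat n) by lia; reflexivity.
Qed.

(** The guard is what remains of the constraint j + k + l + m = s once the inner indices have been
    summed. Trading it for a shorter range turns the box of [quad_sum] into the nested ranges of
    iterated convolutions. *)
Lemma Zsum_restrict (b i s : Z) (f : Z -> C) :
  (0 <= i)%Z -> (s <= b)%Z ->
  Zsum b (fun l => if (i + l <=? s)%Z then f l else 0) =
  if (i <=? s)%Z then Zsum (s - i) f else 0.
Proof.
intros Hi Hs; destruct (Z.leb_spec i s) as [His|His].
- replace b with (s - i + Z.of_nat (Z.to_nat (b - (s - i))))%Z by lia.
  induction (Z.to_nat _) as [|n IH].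
  + rewrite Z.add_0_r; apply Zsum_ext; intros j Hj.
    destruct (Z.leb_spec (i + j) s); [reflexivity|lia].
  + rewrite Zsum_last by lia.
    replace (s - i + Z.of_nat (S n) - 1)%Z with (s - i + Z.of_nat n)%Z by lia.
    rewrite IH; destruct (Z.leb_spec (i + (s - i + Z.of_nat (S n))) s); [lia|ring].
- transitivity (Zsum b (fun _ => 0)); [|apply Zsum_0].
  apply Zsum_ext; intros j Hj.
  destruct (Z.leb_spec (i + j) s); [lia|reflexivity].
Qed.

Lemma Zsum_single (b i s : Z) (f : Z -> C) :
  (0 <= i)%Z -> (s <= b)%Z ->
  Zsum b (fun m => if (i + m =? s)%Z then f m else 0) =
  if (i <=? s)%Z then f (s - i)%Z else 0.
Proof.
intros Hi Hs.
transitivity (Zsum b (fun l => if (i + l <=? s)%Z then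
   (if (i + l =? s)%Z then f l else 0) else 0)).
{ apply Zsum_ext; intros j Hj.
  destruct (Z.leb_spec (i + j) s), (Z.eqb_spec (i + j) s); try reflexivity; lia. }
rewrite Zsum_restrict by assumption.
destruct (Z.leb_spec i s) as [His|His]; [|reflexivity].
rewrite Zsum_last by lia; replace (i + (s - i) =? s)%Z with true by (symmetry; apply Z.eqb_eq; lia).
rewrite (Zsum_ext _ _ (fun _ => 0)), Zsum_0; [ring|].
intros j Hj; destruct (Z.eqb_spec (i + j) s); [lia|reflexivity].
Qed.

Definition weighted (p : Z -> Z) (c : nat -> C) (n : nat) : C :=
  RtoC (IZR (p (Z.of_nat n))) * c n.

Lemma conv_Zsum (x y : nat -> C) (s : Z) :
  (0 <= s)%Z ->
  Zsum s (fun j => x (Z.to_nat j) * y (Z.to_nat (s - j))) = conv x y (Z.to_nat s).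
Proof.
intros Hs; rewrite <- (Z2Nat.id s Hs) at 1; rewrite Zsum_sum_n; unfold conv.
apply sum_n_ext_loc; intros k Hk; rewrite Nat2Z.id; do 2 f_equal; lia.
Qed.

(** This is the bridge from products of four expansions to the sums of the recursion. Weights that
    do not factor into one-variable polynomials are reached by linear combination. *)
Lemma quad_sum_conv (c : nat -> C) (n : nat) (p q r t : Z -> Z) :
  quad_sum c (Z.of_nat n) (Z.of_nat n) (fun j k l m => p j * (q k * (r l * t m)))%Z =
  conv (weighted p c) (conv (weighted q c) (conv (weighted r c) (weighted t c))) n.
Proof.
set (s := Z.of_nat n); unfold quad_sum.
set (P := weighted p c); set (Q := weighted q c).
set (R := weighted r c); set (T := weighted t c).
assert (Hs : (0 <= s)%Z) by (unfold s; lia).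
replace (conv P (conv Q (conv R T)) n) with (conv P (conv Q (conv R T)) (Z.to_nat s))
  by (unfold s; rewrite Nat2Z.id; reflexivity).
rewrite <- conv_Zsum by exact Hs.
apply Zsum_ext; intros j Hj.
transitivity (P (Z.to_nat j) * Zsum s (fun k => if (j + k <=? s)%Z then
  Q (Z.to_nat k) * conv R T (Z.to_nat (s - (j + k))) else 0)).
- rewrite <- Zsum_scal; apply Zsum_ext; intros k Hk.
  transitivity (P (Z.to_nat j) * (Q (Z.to_nat k) *
    Zsum s (fun l => if (j + k + l <=? s)%Z then
      R (Z.to_nat l) * T (Z.to_nat (s - (j + k + l))) else 0))).
  + rewrite <- !Zsum_scal; apply Zsum_ext; intros l Hl.
    rewrite (Zsum_single s (j + k + l) s (fun m => RtoC (IZR (p j * (q k * (r l * t m)))) *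
      (c (Z.to_nat j) * c (Z.to_nat k) * c (Z.to_nat l) * c (Z.to_nat m)))) by lia.
    destruct (Z.leb_spec (j + k + l) s); [|ring].
    unfold P, Q, R, T, weighted; rewrite !Z2Nat.id, !mult_IZR, !RtoC_mult by lia; ring.
  + rewrite (Zsum_restrict s (j + k) s (fun l => R (Z.to_nat l) * T (Z.to_nat (s - (j + k + l))))) by lia.
    destruct (Z.leb_spec (j + k) s); [|ring].
    rewrite <- conv_Zsum by lia; do 2 f_equal; apply Zsum_ext; intros l Hl.
    do 3 f_equal; lia.
- rewrite (Zsum_restrict s j s (fun k => Q (Z.to_nat k) * conv R T (Z.to_nat (s - (j + k))))) by lia.
  destruct (Z.leb_spec j s); [|lia].
  rewrite <- conv_Zsum by lia; f_equal; apply Zsum_ext; intros l Hl.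
  do 3 f_equal; lia.
Qed.

Lemma quad_sum_ext (c d : nat -> C) (s b : Z) (w w' : Z -> Z -> Z -> Z -> Z) :
  (forall j k l m, (0 <= j <= b)%Z -> (0 <= k <= b)%Z -> (0 <= l <= b)%Z ->
    (0 <= m <= b)%Z -> (j + k + l + m = s)%Z ->
    RtoC (IZR (w j k l m)) *
      (c (Z.to_nat j) * c (Z.to_nat k) * c (Z.to_nat l) * c (Z.to_nat m)) =
    RtoC (IZR (w' j k l m)) *
      (d (Z.to_nat j) * d (Z.to_nat k) * d (Z.to_nat l) * d (Z.to_nat m))) ->
  quad_sum c s b w = quad_sum d s b w'.
Proof.
intros H; unfold quad_sum.
do 4 (apply Zsum_ext; intros ? ?).
destruct (Z.eqb_spec (j + j0 + j1 + j2) s); [|reflexivity].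
apply H; assumption.
Qed.

Lemma quad_sum_plus (c : nat -> C) (s b : Z) (v w : Z -> Z -> Z -> Z -> Z) :
  quad_sum c s b (fun j k l m => v j k l m + w j k l m)%Z =
  quad_sum c s b v + quad_sum c s b w.
Proof.
unfold quad_sum.
do 4 (rewrite <- Zsum_plus; apply Zsum_ext; intros ? ?).
destruct (Z.eqb_spec (j + j0 + j1 + j2) s); [|ring].
rewrite plus_IZR, RtoC_plus; ring.
Qed.

Lemma quad_sum_scal (c : nat -> C) (s b a : Z) (w : Z -> Z -> Z -> Z -> Z) :
  quad_sum c s b (fun j k l m => a * w j k l m)%Z = RtoC (IZR a) * quad_sum c s b w.
Proof.
unfold quad_sum.
do 4 (rewrite <- Zsum_scal; apply Zsum_ext; intros ? ?).
destruct (Z.eqb_spec (j + j0 + j1 + j2) s); [|ring].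
rewrite mult_IZR, RtoC_mult; ring.
Qed.

Lemma quad_sum_zero (c : nat -> C) (s b : Z) (w : Z -> Z -> Z -> Z -> Z) :
  (forall j k l m, (0 <= j <= b)%Z -> (0 <= k <= b)%Z -> (0 <= l <= b)%Z ->
    (0 <= m <= b)%Z -> (j + k + l + m = s)%Z ->
    c (Z.to_nat j) = 0 \/ c (Z.to_nat k) = 0 \/ c (Z.to_nat l) = 0 \/ c (Z.to_nat m) = 0) ->
  quad_sum c s b w = 0.
Proof.
intros H.
rewrite (quad_sum_ext c c s b w (fun _ _ _ _ => 0 * 0)%Z).
- rewrite (quad_sum_scal c s b 0 (fun _ _ _ _ => 0)%Z); ring.
- intros j k l m Hj Hk Hl Hm E.
  destruct (H j k l m Hj Hk Hl Hm E) as [-> | [-> | [-> | ->]]]; ring.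
Qed.

Lemma quad_sum_neg (c : nat -> C) (s b : Z) (w : Z -> Z -> Z -> Z -> Z) :
  (b < 0)%Z -> quad_sum c s b w = 0.
Proof. intros H; apply Zsum_neg, H. Qed.

(** An index equal to the total N forces the other three to be 0, and N > 0 makes the four such
    corners distinct. This is how the unknown [c n] is isolated, with the sum of the corner weights
    as its coefficient. *)
Lemma quad_sum_split (c : nat -> C) (n : nat) (w : Z -> Z -> Z -> Z -> Z) :
  c 0%nat = 1 -> (0 < n)%nat ->
  let N := Z.of_nat n in
  quad_sum c N N w =
  RtoC (IZR (w N 0 0 0 + w 0 N 0 0 + w 0 0 N 0 + w 0 0 0 N)%Z) * c n
  + quad_sum c N (N - 1) w.
Proof.
intros c0 Hn N; assert (HN : (0 < N)%Z) by (unfold N; lia).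
assert (HcN : c (Z.to_nat N) = c n) by (unfold N; rewrite Nat2Z.id; reflexivity).
set (term := fun j k l m : Z => if (j + k + l + m =? N)%Z then
  RtoC (IZR (w j k l m)) *
   (c (Z.to_nat j) * c (Z.to_nat k) * c (Z.to_nat l) * c (Z.to_nat m)) else 0).
assert (Hbig : forall j k l m, (j + k + l + m > N)%Z -> term j k l m = 0).
{ intros j k l m H; unfold term; destruct (Z.eqb_spec (j + k + l + m) N); [lia|reflexivity]. }
assert (Hzero : forall b (f : Z -> C), (forall x, (0 <= x <= b)%Z -> f x = 0) -> Zsum b f = 0).
{ intros b f Hf; rewrite (Zsum_ext _ _ (fun _ => 0) Hf); apply Zsum_0. }
assert (Hfirst : forall b (f : Z -> C), (0 <= b)%Z ->
  (forall x, (0 < x <= b)%Z -> f x = 0) -> Zsum b f = f 0%Z).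
{ intros b f Hb Hf.
  rewrite (Zsum_ext _ _ (fun m => if (0 + m =? 0)%Z then f 0%Z else 0)).
  - rewrite (Zsum_single b 0 0 (fun _ => f 0%Z)) by lia; reflexivity.
  - intros j Hj; destruct (Z.eqb_spec (0 + j) 0) as [E|E].
    + f_equal; lia.
    + apply Hf; lia. }
(* [I] is the indicator of 0: a slice with one index equal to N survives only if the indices before
   it sum to 0. [L4] to [L1] evaluate the slices whose later indices stay below N; [S4'] to [S2']
   collect them from the innermost sum outwards. *)
set (I := fun x : Z => if (x =? 0)%Z then RtoC 1 else RtoC 0).
assert (HI : forall x K, (0 <= x)%Z -> Zsum N (fun l => I (x + l)%Z * K) = I x * K).
{ intros x K Hx; rewrite Hfirst by (intros; unfold I; try destruct (Z.eqb_spec (x + x0) 0); try lia; ring).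
  rewrite Z.add_0_r; reflexivity. }
set (K1 := RtoC (IZR (w N 0 0 0)%Z) * c n).
set (K2 := RtoC (IZR (w 0 N 0 0)%Z) * c n).
set (K3 := RtoC (IZR (w 0 0 N 0)%Z) * c n).
set (K4 := RtoC (IZR (w 0 0 0 N)%Z) * c n).
assert (L4 : forall x y z, (0 <= x)%Z -> (0 <= y)%Z -> (0 <= z)%Z ->
  term x y z N = I (x + y + z)%Z * K4).
{ intros x y z Hx Hy Hz; unfold I; destruct (Z.eqb_spec (x + y + z) 0).
  - replace x with 0%Z by lia; replace y with 0%Z by lia; replace z with 0%Z by lia.
    unfold term; rewrite Z.add_0_l, Z.eqb_refl, HcN; change (Z.to_nat 0) with 0%nat; rewrite c0; unfold K4; ring.
  - rewrite Hbig by lia; ring. }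
assert (L3 : forall x y, (0 <= x)%Z -> (0 <= y)%Z ->
  Zsum (N - 1) (term x y N) = I (x + y)%Z * K3).
{ intros x y Hx Hy; unfold I; destruct (Z.eqb_spec (x + y) 0).
  - rewrite Hfirst by (intros; try apply Hbig; lia).
    replace x with 0%Z by lia; replace y with 0%Z by lia.
    unfold term; rewrite Z.add_0_r, Z.add_0_l, Z.eqb_refl, HcN; change (Z.to_nat 0) with 0%nat; rewrite c0; unfold K3; ring.
  - rewrite Hzero by (intros; apply Hbig; lia); ring. }
assert (L2 : forall x, (0 <= x)%Z ->
  Zsum (N - 1) (fun l => Zsum (N - 1) (term x N l)) = I x * K2).
{ intros x Hx; unfold I; destruct (Z.eqb_spec x 0).
  - rewrite Hfirst, Hfirst by (intros; try apply Hzero; intros; try apply Hbig; lia).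
    subst x; unfold term; rewrite !Z.add_0_r, Z.add_0_l, Z.eqb_refl, HcN; change (Z.to_nat 0) with 0%nat; rewrite c0; unfold K2; ring.
  - rewrite Hzero by (intros; apply Hzero; intros; apply Hbig; lia); ring. }
assert (L1 : Zsum (N - 1) (fun k => Zsum (N - 1) (fun l => Zsum (N - 1) (term N k l))) = K1).
{ rewrite !Hfirst by (intros; repeat (apply Hzero; intros); try apply Hbig; lia).
  unfold term; rewrite !Z.add_0_r, Z.eqb_refl, HcN; change (Z.to_nat 0) with 0%nat; rewrite c0; unfold K1; ring. }
assert (S4' : forall x y z, (0 <= x)%Z -> (0 <= y)%Z -> (0 <= z)%Z ->
  Zsum N (term x y z) = Zsum (N - 1) (term x y z) + I (x + y + z)%Z * K4).
{ intros; rewrite Zsum_last, L4 by lia; reflexivity. }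
assert (S3' : forall x y, (0 <= x)%Z -> (0 <= y)%Z ->
  Zsum N (fun l => Zsum N (term x y l)) =
  Zsum (N - 1) (fun l => Zsum (N - 1) (term x y l)) + I (x + y)%Z * (K3 + K4)).
{ intros x y Hx Hy.
  rewrite (Zsum_ext N _ _ (fun l Hl => S4' x y l Hx Hy (proj1 Hl))).
  rewrite Zsum_plus, (HI (x + y)%Z), Zsum_last, L3 by lia; ring. }
assert (S2' : forall x, (0 <= x)%Z ->
  Zsum N (fun k => Zsum N (fun l => Zsum N (term x k l))) =
  Zsum (N - 1) (fun k => Zsum (N - 1) (fun l => Zsum (N - 1) (term x k l)))
  + I x * (K2 + K3 + K4)).
{ intros x Hx.
  rewrite (Zsum_ext N _ _ (fun k Hk => S3' x k Hx (proj1 Hk))).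
  rewrite Zsum_plus, (HI x), Zsum_last, L2 by lia; ring. }
change (quad_sum c N N w) with
  (Zsum N (fun j => Zsum N (fun k => Zsum N (fun l => Zsum N (term j k l))))).
change (quad_sum c N (N - 1) w) with
  (Zsum (N-1) (fun j => Zsum (N-1) (fun k => Zsum (N-1) (fun l => Zsum (N-1) (term j k l))))).
rewrite (Zsum_ext N _ _ (fun j Hj => S2' j (proj1 Hj))).
rewrite Zsum_plus, (HI 0%Z), Zsum_last, L1 by lia.
rewrite !plus_IZR, !RtoC_plus; unfold K1, K2, K3, K4; change (I 0%Z) with (RtoC 1); ring.
Qed.

(** * Expansions of quartic forms in tau *)

Lemma Cseries_Csum (x : nat -> C) (l : C) : Cseries x l -> Csum x = l.
Proof.
rewrite Cseries_components; intros [H1 H2].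
apply injective_projections; [exact (is_series_unique _ _ H1)|exact (is_series_unique _ _ H2)].
Qed.

Lemma expands_const (k : C) :
  expands (fun _ => k) (fun n => match n with 0%nat => k | _ => 0 end).
Proof.
apply expands_of_series, filter_forall; intros z.
apply Cseries_ext with (fun n => match n with 0%nat => k | _ => 0 end * 0 ^ n);
  [intros [|n]; ring|].
exact (Cseries_at_0 (fun n => match n with 0%nat => k | _ => 0 end)).
Qed.

Lemma expands_id : exists a, expands (fun z => z) a.
Proof.
eexists; eapply expands_ext; [| |exact (expands_shift _ _ (expands_const 1))].
- apply filter_forall; intros z; simpl; ring.
- reflexivity.
Qed.

Ltac expands_tac :=
  lazymatch goal with
  | |- expands (fun _ => ?k) _ => exact (expands_const k)
  | |- expands (fun w => @?f w + @?g w) _ =>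
      eapply (expands_plus f g); expands_tac
  | |- expands (fun w => @?f w - @?g w) _ =>
      eapply (expands_minus f g); expands_tac
  | |- expands (fun w => @?f w * @?g w) _ =>
      eapply (expands_mult f g); expands_tac
  | |- expands _ _ => cbv beta; eassumption
  end.

Lemma expands_quad (c : nat -> C) (f1 f2 f3 f4 : C -> C) (p q r t : Z -> Z) :
  expands f1 (weighted p c) -> expands f2 (weighted q c) ->
  expands f3 (weighted r c) -> expands f4 (weighted t c) ->
  expands (fun z => f1 z * (f2 z * (f3 z * f4 z)))
    (fun n => quad_sum c (Z.of_nat n) (Z.of_nat n)
       (fun j k l m => p j * (q k * (r l * t m)))%Z).
Proof.
intros H1 H2 H3 H4.
apply (expands_coeff_ext _ (conv (weighted p c) (conv (weighted q c)
  (conv (weighted r c) (weighted t c))))).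
{ intros n; symmetry; apply quad_sum_conv. }
apply (expands_mult f1 (fun z => f2 z * (f3 z * f4 z))); [assumption|].
apply (expands_mult f2 (fun z => f3 z * f4 z)); [assumption|].
apply expands_mult; assumption.
Qed.

Lemma expands_quad_plus (c : nat -> C) (f g : C -> C) (v w : Z -> Z -> Z -> Z -> Z) :
  expands f (fun n => quad_sum c (Z.of_nat n) (Z.of_nat n) v) ->
  expands g (fun n => quad_sum c (Z.of_nat n) (Z.of_nat n) w) ->
  expands (fun z => f z + g z) (fun n => quad_sum c (Z.of_nat n) (Z.of_nat n)
    (fun j k l m => v j k l m + w j k l m)%Z).
Proof.
intros Hf Hg; eapply expands_coeff_ext; [|exact (expands_plus _ _ _ _ Hf Hg)].
intros n; symmetry; apply quad_sum_plus.
Qed.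

Lemma expands_quad_scal (c : nat -> C) (f : C -> C) (a : Z) (w : Z -> Z -> Z -> Z -> Z) :
  expands f (fun n => quad_sum c (Z.of_nat n) (Z.of_nat n) w) ->
  expands (fun z => RtoC (IZR a) * f z) (fun n => quad_sum c (Z.of_nat n) (Z.of_nat n)
    (fun j k l m => a * w j k l m)%Z).
Proof.
intros Hf; eapply expands_coeff_ext; [|exact (expands_scal _ _ _ Hf)].
intros n; symmetry; apply quad_sum_scal.
Qed.

Lemma expands_weight_ext (c : nat -> C) (f g : C -> C) (v w : Z -> Z -> Z -> Z -> Z) :
  (forall z, f z = g z) -> (forall j k l m, v j k l m = w j k l m) ->
  expands f (fun n => quad_sum c (Z.of_nat n) (Z.of_nat n) v) ->
  expands g (fun n => quad_sum c (Z.of_nat n) (Z.of_nat n) w).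
Proof.
intros Hfg Hvw; apply expands_ext.
- apply filter_forall; exact Hfg.
- intros n; apply quad_sum_ext; intros; rewrite Hvw; reflexivity.
Qed.

(** Source of the index shifts 4, 5 and 6 in [S4], [S5], [S6]. For n < d the bound is negative and
    the empty sum agrees with the vanishing coefficient. *)
Lemma expands_quad_shift (c : nat -> C) (f : C -> C) (d : nat) (w : Z -> Z -> Z -> Z -> Z) :
  expands f (fun n => quad_sum c (Z.of_nat n) (Z.of_nat n) w) ->
  expands (fun z => z ^ d * f z) (fun n =>
    quad_sum c (Z.of_nat n - Z.of_nat d) (Z.of_nat n - Z.of_nat d) w).
Proof.
intros Hf; induction d as [|d IH].
- eapply expands_ext; [| |exact Hf].
  + apply filter_forall; intros z; simpl; ring.
  + intros n; simpl; rewrite Z.sub_0_r; reflexivity.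
- eapply expands_ext; [| |exact (expands_shift _ _ IH)].
  + apply filter_forall; intros z; simpl; ring.
  + intros [|n]; unfold shift.
    * symmetry; apply quad_sum_neg; lia.
    * f_equal; lia.
Qed.

(* [s z = tau z / z]; a factor [z] accompanies each derivative of order at least
   two, so that all expansions are indexed by the subscript of [c]. *)
Definition tau_expansions (c : nat -> C) (s T0 T1 T2 T3 T4 : C -> C) : Prop :=
  expands s (weighted (fun _ => 1)%Z c) /\
  expands T1 (weighted (fun j => j + 1)%Z c) /\
  expands (fun z => z * T2 z) (weighted (fun j => j * (j + 1))%Z c) /\
  expands (fun z => z * (z * T3 z)) (weighted (fun j => (j - 1) * (j * (j + 1)))%Z c) /\
  expands (fun z => z * (z * (z * T4 z)))
    (weighted (fun j => (j - 2) * ((j - 1) * (j * (j + 1))))%Z c) /\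
  locally (0 : C) (fun z => T0 z = z * s z /\ Cderives T0 z (T1 z) /\
    Cderives T1 z (T2 z) /\ Cderives T2 z (T3 z) /\ Cderives T3 z (T4 z)).

Lemma tau_taylor_expands (tau : C -> C) (c : nat -> C) :
  tau_taylor tau c -> expands tau (shift c).
Proof.
intros H; apply expands_of_series; revert H; unfold tau_taylor.
apply filter_imp; intros z Hz.
apply (is_series_decr_1 (V := C_NormedModule)).
replace (plus (tau z : C_NormedModule) _) with (tau z)
  by (unfold plus, opp; simpl; ring).
eapply Cseries_ext; [|exact Hz]; intros n; cbv beta.
rewrite Nat.add_1_r; reflexivity.
Qed.

Lemma tau_taylor_expansions (tau : C -> C) (c : nat -> C) :
  tau_taylor tau c ->
  tau_expansions c (fun z => Csum (fun n => c n * z ^ n)) tau (C_derive tau)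
    (C_derive (C_derive tau)) (C_derive (C_derive (C_derive tau)))
    (C_derive (C_derive (C_derive (C_derive tau)))).
Proof.
intros Hc; assert (H0 := tau_taylor_expands tau c Hc).
destruct (expands_derive _ _ H0) as [H1 D1].
destruct (expands_derive _ _ H1) as [H2 D2].
destruct (expands_derive _ _ H2) as [H3 D3].
destruct (expands_derive _ _ H3) as [H4 D4].
destruct (expands_unshift _ _ H0 eq_refl) as [Hs Es].
assert (Hnat : forall n, RtoC (INR n) = RtoC (IZR (Z.of_nat n)))
  by (intros; rewrite INR_IZR_INZ; reflexivity).
repeat split.
- revert Hs; apply expands_coeff_ext; intros n; unfold weighted, shift; ring.
- revert H1; apply expands_coeff_ext; intros n; unfold weighted, deriv, shift.
  rewrite Hnat; do 3 f_equal; lia.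
- apply expands_shift in H2; revert H2; apply expands_coeff_ext; intros [|n].
  + unfold weighted; simpl; ring.
  + unfold weighted, shift, deriv; rewrite !Hnat, Cmult_assoc, <- RtoC_mult, <- mult_IZR.
    do 3 f_equal; lia.
(* Below the shift the coefficient is 0, in agreement with the weight, whose factors [j - 1] and [j]
   vanish at the two lowest indices; the fourth derivative gains [j - 2] in the same way. *)
- do 2 apply expands_shift in H3; revert H3; apply expands_coeff_ext; intros [|[|n]];
    try (unfold weighted; simpl; ring).
  unfold weighted, shift, deriv.
  rewrite !Hnat, !Cmult_assoc, <- !RtoC_mult, <- !mult_IZR.
  do 3 f_equal; rewrite !Nat2Z.inj_succ; ring.
- do 3 apply expands_shift in H4; revert H4; apply expands_coeff_ext; intros [|[|[|n]]];
    try (unfold weighted; simpl; ring).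
  unfold weighted, shift, deriv.
  rewrite !Hnat, !Cmult_assoc, <- !RtoC_mult, <- !mult_IZR.
  do 3 f_equal; rewrite !Nat2Z.inj_succ; ring.
- generalize (filter_and _ _ Es (filter_and _ _ D1 (filter_and _ _ D2
    (filter_and _ _ D3 D4)))).
  apply filter_imp; intros z [E [E1 [E2 [E3 E4]]]]; auto.
Qed.

(** Since [s 0 = c 0 = 1], the only zero of [T0] near the origin comes from the factor [z]. *)
Lemma tau_punctured_neq0 (c : nat -> C) (s T0 T1 T2 T3 T4 : C -> C) :
  c 0%nat = 1 -> tau_expansions c s T0 T1 T2 T3 T4 ->
  locally (0 : C) (fun z : C => s z <> 0 /\ (z <> 0 -> T0 z <> 0)).
Proof.
intros c0 (Hs & _ & _ & _ & _ & Hloc).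
destruct (expands_derive _ _ Hs) as [_ Ds].
assert (s0 : s 0 <> 0).
{ rewrite (expands_at_0 _ _ Hs); unfold weighted; rewrite c0, Cmult_1_r.
  intros E; apply RtoC_inj in E; lra. }
generalize (filter_and _ _ (Cderives_neq0 _ _ _ (locally_singleton _ _ Ds) s0) Hloc).
apply filter_imp; intros z [Hz [E _]]; split; [exact Hz|].
intros Hz0; rewrite E; apply Cmult_neq_0; assumption.
Qed.

(* Comparing coefficients after multiplication by [s ^ 2] keeps every sum in the
   form [quad_sum]. *)
Lemma bilinear_low_coeffs (c : nat -> C) (g2 lam : C) (s T0 T1 T2 T3 T4 : C -> C) :
  c 0%nat = 1 -> c 1%nat = 0 -> tau_expansions c s T0 T1 T2 T3 T4 ->
  locally' (0 : C) (fun z : C => T0 z * T4 z - 4 * T1 z * T3 z + 3 * T2 z ^ 2 =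
    (6 * lam * z + g2 / 2) * T0 z ^ 2) ->
  c 2%nat = 0 /\ c 3%nat = 0.
Proof.
intros c0 c1 (Hs & H1 & H2 & H3 & H4 & Hloc) HH.
set (wH := fun j k l m : Z => ((j - 2) * ((j - 1) * (j * (j + 1)))
  - 4 * ((j - 1) * (j * (j + 1)) * (k + 1)) + 3 * ((j * (j + 1)) * (k * (k + 1))))%Z).
assert (HL : expands (fun z => s z * s z *
   (z * (z * (z * T4 z)) * s z - 4 * (z * (z * T3 z) * T1 z)
    + 3 * ((z * T2 z) * (z * T2 z))))
  (fun n => quad_sum c (Z.of_nat n) (Z.of_nat n) wH)).
{ assert (Q := expands_quad_plus _ _ _ _ _
    (expands_quad_plus _ _ _ _ _ (expands_quad _ _ _ _ _ _ _ _ _ H4 Hs Hs Hs)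
     (expands_quad_scal _ _ (-4) _ (expands_quad _ _ _ _ _ _ _ _ _ H3 H1 Hs Hs)))
    (expands_quad_scal _ _ 3 _ (expands_quad _ _ _ _ _ _ _ _ _ H2 H2 Hs Hs))).
  eapply expands_weight_ext; [| |exact Q].
  - intros z; simpl; ring.
  - intros; unfold wH; ring. }
assert (HR0 := expands_quad _ _ _ _ _ _ _ _ _ Hs Hs Hs Hs).
assert (HR := expands_plus _ _ _ _
  (expands_scal (g2 / 2) _ _ (expands_quad_shift _ _ 4 _ HR0))
  (expands_scal (6 * lam) _ _ (expands_quad_shift _ _ 5 _ HR0))).
assert (E := expands_unique _ _ _ _ HL HR).
(* The right-hand side starts at index 4, hence the bound on n. The corners of [wH] add up to (n -
   6)(n - 1)n(n + 1), that is -24 for n = 2 and -72 for n = 3. *)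
assert (Hcoef : forall n, (1 < n < 4)%nat ->
  quad_sum c (Z.of_nat n) (Z.of_nat n - 1) wH = 0 -> c n = 0).
{ intros n Hn Hq.
  assert (En : quad_sum c (Z.of_nat n) (Z.of_nat n) wH = 0).
  { rewrite E.
    - rewrite !quad_sum_neg by lia; ring.
    - unfold locally', within in *; generalize (filter_and _ _ HH Hloc).
      apply filter_imp; intros z [Hz [Ez _]] Hz0; specialize (Hz Hz0).
      rewrite Ez in Hz; simpl.
      replace (_ * _ * (_ - _ + _)) with (z ^ 2 * s z * s z *
        (z * s z * T4 z - 4 * T1 z * T3 z + 3 * T2 z ^ 2)) by (simpl; ring).
      rewrite Hz; simpl; field; intros E'; apply RtoC_inj in E'; lra. }
  rewrite quad_sum_split, Hq in En by (try assumption; lia).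
  set (K := (_ + _ + _ + _)%Z) in En.
  assert (HK : RtoC (IZR K) <> 0).
  { intros E'; apply RtoC_inj, eq_IZR in E'.
    destruct n as [|[|[|[|n]]]]; try lia; unfold K, wH in E'; simpl in E'; lia. }
  replace (c n) with (/ IZR K * (IZR K * c n + 0)) by (field; exact HK).
  rewrite En; ring. }

assert (c2 : c 2%nat = 0).
{ apply Hcoef; [lia|]; apply quad_sum_zero; intros j k l m Hj Hk Hl Hm E'.
  assert (HZ : (j = 1 \/ k = 1 \/ l = 1 \/ m = 1)%Z) by lia.
  destruct HZ as [-> | [-> | [-> | ->]]]; auto. }
split; [exact c2|].
apply Hcoef; [lia|]; apply quad_sum_zero; intros j k l m Hj Hk Hl Hm E'.
assert (Hz : forall x, (1 <= x <= 2)%Z -> c (Z.to_nat x) = 0).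
{ intros x Hx; assert (Hx' : (x = 1 \/ x = 2)%Z) by lia; destruct Hx' as [-> | ->]; assumption. }
assert (HZ : (1 <= j \/ 1 <= k \/ 1 <= l \/ 1 <= m)%Z) by lia.
destruct HZ as [HZ | [HZ | [HZ | HZ]]]; [left|right; left|do 2 right; left|do 3 right];
  apply Hz; lia.
Qed.

(** * The recursion *)

(** If no index lies in 1..3, each is 0 or at least 4. Two nonzero ones would exceed 7, and a single
    one would equal n, which the bound n - 1 excludes. *)
Lemma sparse_quad_sum (c : nat -> C) (n : nat) (w : Z -> Z -> Z -> Z -> Z) :
  c 1%nat = 0 -> c 2%nat = 0 -> c 3%nat = 0 -> (1 <= n <= 7)%nat ->
  quad_sum c (Z.of_nat n) (Z.of_nat n - 1) w = 0.
Proof.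
intros c1 c2 c3 Hn; apply quad_sum_zero; intros j k l m Hj Hk Hl Hm E.
assert (Hz : forall x, (1 <= x <= 3)%Z -> c (Z.to_nat x) = 0).
{ intros x Hx; assert (Hx' : (x = 1 \/ x = 2 \/ x = 3)%Z) by lia.
  destruct Hx' as [-> | [-> | ->]]; assumption. }
assert (HZ : (1 <= j <= 3 \/ 1 <= k <= 3 \/ 1 <= l <= 3 \/ 1 <= m <= 3)%Z) by lia.
destruct HZ as [HZ | [HZ | [HZ | HZ]]]; [left|right; left|do 2 right; left|do 3 right];
  apply Hz; lia.
Qed.

Lemma quad_sum_at_0 (c : nat -> C) (w : Z -> Z -> Z -> Z -> Z) :
  c 0%nat = 1 -> quad_sum c 0 0 w = RtoC (IZR (w 0 0 0 0)%Z).
Proof.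
intros c0; unfold quad_sum, Zsum; simpl; rewrite c0; ring.
Qed.

(** Compare coefficients of z^6 in U s^4 = s^2 (T1^2 - s z T2), where U = z^2 u and T0 = z s. The
    left side contributes a_6 + 4 c_6; the corners on the right are -35 + 7 + 1 + 1 = -26. *)
Lemma laurent_coeff_6 (c a : nat -> C) (u s T0 T1 T2 T3 T4 : C -> C) :
  c 0%nat = 1 -> c 1%nat = 0 -> c 2%nat = 0 -> c 3%nat = 0 ->
  tau_expansions c s T0 T1 T2 T3 T4 ->
  a 0%nat = 1 ->
  locally' (0 : C) (fun z : C => Cseries (fun n => a n * (z ^ n / z ^ 2)) (u z)) ->
  locally' (0 : C) (fun z : C => u z = (T1 z ^ 2 - T0 z * T2 z) / T0 z ^ 2) ->
  a 6%nat = - (30) * c 6%nat.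
Proof.
intros c0 c1 c2 c3 Hexp a0 Ha Hu.
assert (Hnz := tau_punctured_neq0 _ _ _ _ _ _ _ c0 Hexp).
destruct Hexp as (Hs & H1 & H2 & H3 & H4 & Hloc).
(* Summing the series, rather than taking [z ^ 2 * u z], gives the value [a 0] at the origin, where
   the value of [u] carries no information. *)
set (U := fun z : C => Csum (fun n => a n * z ^ n)).
assert (HUz : locally' (0 : C) (fun z : C => Cseries (fun n => a n * z ^ n) (z ^ 2 * u z))).
{ unfold locally', within in *; revert Ha; apply filter_imp; intros z Hz Hz0.
  specialize (Hz Hz0).
  eapply Cseries_ext; [|exact (is_series_scal (z ^ 2) _ _ Hz)].
  intros n; unfold scal; simpl; unfold mult; simpl; field; exact Hz0. }
assert (HU : expands U a).
{ apply expands_of_series; unfold locally', within in HUz; revert HUz.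
  apply filter_imp; intros z Hz; unfold U.
  destruct (Ceq_dec z 0) as [->|Hz0].
  - rewrite (Cseries_Csum _ _ (Cseries_at_0 a)); apply Cseries_at_0.
  - rewrite (Cseries_Csum _ _ (Hz Hz0)); exact (Hz Hz0). }
assert (HL := expands_mult _ _ _ _ HU (expands_quad _ _ _ _ _ _ _ _ _ Hs Hs Hs Hs)).
set (wR := fun j k l m : Z => ((j + 1) * (k + 1) - j * (j + 1))%Z).
assert (HR : expands (fun z => s z * s z * (T1 z * T1 z - s z * (z * T2 z)))
  (fun n => quad_sum c (Z.of_nat n) (Z.of_nat n) wR)).
{ assert (Q := expands_quad_plus _ _ _ _ _ (expands_quad _ _ _ _ _ _ _ _ _ H1 H1 Hs Hs)
    (expands_quad_scal _ _ (-1) _ (expands_quad _ _ _ _ _ _ _ _ _ H2 Hs Hs Hs))).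
  eapply expands_weight_ext; [| |exact Q].
  - intros z; simpl; ring.
  - intros; unfold wR; ring. }
assert (E := expands_unique _ _ _ _ HL HR).
assert (E' : locally' (0 : C) (fun z : C => U z * (s z * (s z * (s z * s z))) =
  s z * s z * (T1 z * T1 z - s z * (z * T2 z)))).
{ unfold locally', within in *.
  generalize (filter_and _ _ HUz (filter_and _ _ Hu (filter_and _ _ Hloc Hnz))).
  apply filter_imp; intros z [HzU [Hzu [[Ez _] [Hsz HTz]]]] Hz0.
  unfold U; rewrite (Cseries_Csum _ _ (HzU Hz0)), (Hzu Hz0), Ez.
  field; split; assumption. }
specialize (E E'); cbv beta in E.
set (q := fun n : nat => quad_sum c (Z.of_nat n) (Z.of_nat n)
  (fun _ _ _ _ => (1 * (1 * (1 * 1)))%Z)) in E.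
assert (Hq0 : q 0%nat = 1) by exact (quad_sum_at_0 c (fun _ _ _ _ => 1 * (1 * (1 * 1)))%Z c0).
assert (Hq : forall n, (1 <= n <= 6)%nat -> q n = 4 * c n).
{ intros n Hn; unfold q; rewrite quad_sum_split, sparse_quad_sum by (try assumption; lia).
  simpl; ring. }
(* Orders 1 and 2 are compared as well, because a_1 and a_2 multiply c_5 and c_4, which may be
   nonzero; a_3, a_4 and a_5 meet only vanishing coefficients. *)
assert (E1 := E 1%nat); assert (E2 := E 2%nat); specialize (E 6%nat).
rewrite quad_sum_split, sparse_quad_sum in E1, E2, E by (try assumption; lia).
unfold conv in E1, E2, E; fold q in E1, E2, E.
rewrite !sum_Sn, sum_O in E1; rewrite !sum_Sn, sum_O in E2; rewrite !sum_Sn, sum_O in E.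
unfold plus in E1, E2, E; simpl in E1, E2, E.
rewrite !Hq, Hq0, a0, c1 in E1 by lia.
assert (a1 : a 1%nat = 0).
{ replace (a 1%nat) with (1 * (4 * 0) + a 1%nat * 1) by ring; rewrite E1; ring. }
rewrite !Hq, Hq0, a0, a1, c1, c2 in E2 by lia.
assert (a2 : a 2%nat = 0).
{ replace (a 2%nat) with (1 * (4 * 0) + 0 * (4 * 0) + a 2%nat * 1) by ring; rewrite E2; ring. }
rewrite !Hq, Hq0, a0, a1, a2, c1, c2, c3 in E by lia.
transitivity (1 * (4 * c 6%nat) + 0 * (4 * c 5%nat) + 0 * (4 * c 4%nat) +
  a 3%nat * (4 * 0) + a 4%nat * (4 * 0) + a 5%nat * (4 * 0) + a 6%nat * 1 - 4 * c 6%nat);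
  [ring|rewrite E; ring].
Qed.

(** u'^2 and 4 u^3 separately have denominator t0^6, but the terms in t1^6 and t0 t1^4 t2 cancel in
    their difference, so t0^4 clears the first integral and the degree is four. *)
Definition quartic (g2 lam g3 z t0 t1 t2 t3 : C) : C :=
  t0 * t0 * (t3 * t3) - 6 * (t0 * (t1 * (t2 * t3))) + 4 * (t1 * (t1 * (t1 * t3)))
  - 3 * (t1 * (t1 * (t2 * t2))) + 4 * (t0 * (t2 * (t2 * t2)))
  - g2 * (t0 * (t0 * (t0 * t2 - t1 * t1)))
  - 12 * (lam * (z * (t0 * (t0 * (t0 * t2 - t1 * t1))) - t0 * (t0 * (t0 * t1))))
  + g3 * (t0 * (t0 * (t0 * t0))).

(* In terms of [u = - (log T0)''], [quartic / T0 ^ 4] is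
   [u' ^ 2 - 4 u ^ 3 + g2 u + 12 lam (z u + (log T0)') + g3], which the
   Painleve equation makes constant. *)
Lemma quartic_derivative (g2 lam g3 z : C) (T0 T1 T2 T3 T4 : C -> C) :
  Cderives T0 z (T1 z) -> Cderives T1 z (T2 z) ->
  Cderives T2 z (T3 z) -> Cderives T3 z (T4 z) ->
  T0 z * T4 z - 4 * T1 z * T3 z + 3 * T2 z ^ 2 = (6 * lam * z + g2 / 2) * T0 z ^ 2 ->
  C_derive (fun w => quartic g2 lam g3 w (T0 w) (T1 w) (T2 w) (T3 w)) z * T0 z =
  4 * (T1 z * quartic g2 lam g3 z (T0 z) (T1 z) (T2 z) (T3 z)).
Proof.
intros D0 D1 D2 D3 HH.
(* The identity for [l] needs no bilinear equation. It is the Painleve equation times its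
   integrating factor 2 u': the cofactor [2 * (...)] equals -2 T0^3 u', and the last factor is the
   defect in Hirota's equation. *)
assert (HD : exists l,
  Cderives (fun w => quartic g2 lam g3 w (T0 w) (T1 w) (T2 w) (T3 w)) z l /\
  l * T0 z = 4 * (T1 z * quartic g2 lam g3 z (T0 z) (T1 z) (T2 z) (T3 z))
   + 2 * (T0 z ^ 2 * T3 z - 3 * T0 z * T1 z * T2 z + 2 * T1 z ^ 3) *
     ((T0 z * T4 z - 4 * T1 z * T3 z + 3 * T2 z ^ 2)
      - (6 * lam * z + g2 / 2) * T0 z ^ 2)).
{ eexists; split.
  { unfold quartic; Cderives_tac. }
  unfold quartic; simpl; field; intros E'; apply RtoC_inj in E'; lra. }
destruct HD as [l [HD Hl]].
rewrite (is_C_derive_unique _ _ _ HD), Hl, HH; ring.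
Qed.

(** After multiplication by z^2 each purely differential product becomes a product of [s], T1, z T2,
    z^2 T3, while the terms in [g2], [lam], [g3] keep z^4, z^5, z^6. [btilde] is not symmetric;
    assigning [j], [k], [l], [m] to the factors by decreasing order of derivative reproduces it
    exactly, without symmetrization. *)
Lemma quartic_expansion (c : nat -> C) (g2 lam g3 : C) (s T0 T1 T2 T3 T4 : C -> C) :
  tau_expansions c s T0 T1 T2 T3 T4 ->
  expands (fun z => z * (z * quartic g2 lam g3 z (T0 z) (T1 z) (T2 z) (T3 z)))
    (fun n => let N := Z.of_nat n in
       quad_sum c N N btilde - g2 * S4 c N - 12 * lam * S5 c N + g3 * S6 c N).
Proof.
intros (Hs & H1 & H2 & H3 & _ & Hloc).
assert (Q3 := expands_quad_plus _ _ _ _ _ (expands_quad_plus _ _ _ _ _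
  (expands_quad_plus _ _ _ _ _ (expands_quad_plus _ _ _ _ _
    (expands_quad _ _ _ _ _ _ _ _ _ H3 H3 Hs Hs)
    (expands_quad_scal _ _ (-6) _ (expands_quad _ _ _ _ _ _ _ _ _ H3 H2 H1 Hs)))
    (expands_quad_scal _ _ 4 _ (expands_quad _ _ _ _ _ _ _ _ _ H3 H1 H1 H1)))
    (expands_quad_scal _ _ (-3) _ (expands_quad _ _ _ _ _ _ _ _ _ H2 H2 H1 H1)))
    (expands_quad_scal _ _ 4 _ (expands_quad _ _ _ _ _ _ _ _ _ H2 H2 H2 Hs))).
assert (Q4 := expands_quad_plus _ _ _ _ _ (expands_quad _ _ _ _ _ _ _ _ _ H2 Hs Hs Hs)
  (expands_quad_scal _ _ (-1) _ (expands_quad _ _ _ _ _ _ _ _ _ H1 H1 Hs Hs))).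
assert (Q5 := expands_quad_plus _ _ _ _ _ Q4
  (expands_quad_scal _ _ (-1) _ (expands_quad _ _ _ _ _ _ _ _ _ H1 Hs Hs Hs))).
assert (Q6 := expands_quad _ _ _ _ _ _ _ _ _ Hs Hs Hs Hs).
assert (Q := expands_plus _ _ _ _ (expands_minus _ _ _ _ (expands_minus _ _ _ _ Q3
  (expands_scal g2 _ _ (expands_quad_shift _ _ 4 _ Q4)))
  (expands_scal (12 * lam) _ _ (expands_quad_shift _ _ 5 _ Q5)))
  (expands_scal g3 _ _ (expands_quad_shift _ _ 6 _ Q6))).
eapply expands_ext; [| |exact Q].
- revert Hloc; apply filter_imp; intros z [Ez _]; rewrite Ez; unfold quartic; simpl; ring.
- intros n; unfold S4, S5, S6; simpl Z.of_nat.
  apply (f_equal2 Cplus); [apply (f_equal2 Cminus); [apply (f_equal2 Cminus)|]|];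
    try apply (f_equal (Cmult _)); apply quad_sum_ext; intros j k l m _ _ _ _ _;
    unfold btilde; do 3 f_equal; ring.
Qed.

Lemma expansions_recursion (c : nat -> C) (g2 lam g3 : C) (s T0 T1 T2 T3 T4 : C -> C) :
  c 0%nat = 1 -> c 1%nat = 0 -> c 2%nat = 0 -> c 3%nat = 0 ->
  840 * c 6%nat + g3 = 0 ->
  expands T0 (shift c) -> tau_expansions c s T0 T1 T2 T3 T4 ->
  locally' (0 : C) (fun z : C => T0 z * T4 z - 4 * T1 z * T3 z + 3 * T2 z ^ 2 =
    (6 * lam * z + g2 / 2) * T0 z ^ 2) ->
  forall n, tau_recursion g2 lam g3 c n.
Proof.
intros c0 c1 c2 c3 c6 H0 Hexp HH.
assert (HE := quartic_expansion c g2 lam g3 _ _ _ _ _ _ Hexp).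
set (e := fun n : nat => _) in HE.
set (G := fun z => quartic g2 lam g3 z (T0 z) (T1 z) (T2 z) (T3 z)) in *.
(* The linear equation for G is compared coefficientwise, so G itself is expanded, not only z^2 G;
   the shape of its coefficients is irrelevant here. *)
assert (HG : exists g, expands G g).
{ destruct Hexp as (_ & _ & _ & _ & _ & Hloc).
  destruct expands_id as [i Hi].
  assert (HT : forall f f' a, expands f a ->
    locally (0 : C) (fun z : C => Cderives f z (f' z)) -> expands f' (deriv a)).
  { intros f f' a Hf Hf'; destruct (expands_derive _ _ Hf) as [Hd _].
    revert Hd; apply expands_ext; [|reflexivity].
    revert Hf'; apply filter_imp; intros z Hz; apply is_C_derive_unique, Hz. }
  assert (H1 : expands T1 (deriv (shift c))).
  { apply (HT T0); [exact H0|revert Hloc; apply filter_imp; intros z Hz; apply Hz]. }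
  assert (H2 : expands T2 (deriv (deriv (shift c)))).
  { apply (HT T1); [exact H1|revert Hloc; apply filter_imp; intros z Hz; apply Hz]. }
  assert (H3 : expands T3 (deriv (deriv (deriv (shift c))))).
  { apply (HT T2); [exact H2|revert Hloc; apply filter_imp; intros z Hz; apply Hz]. }
  eexists; unfold G, quartic; expands_tac. }
destruct HG as [g Hg].
assert (He : forall n, shift (shift g) n = e n).
{ apply (expands_unique _ _ _ _ (expands_shift _ _ (expands_shift _ _ Hg)) HE).
  unfold locally', within; apply filter_forall; intros z _; reflexivity. }
(* [e 6] is the coefficient of z^4 in G. Here 840 = 4 * 6 * 35; [S4] and [S5] have totals 2 and 1
   and vanish since c_1 = c_2 = 0, while [S6] has total 0 and equals 1. *)
assert (e6 : e 6%nat = 0).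
{ unfold e; rewrite quad_sum_split, sparse_quad_sum by (try assumption; lia).
  unfold S4, S5, S6; simpl (Z.of_nat 6).
  assert (Hlow : forall n w, (1 <= n <= 3)%nat ->
    quad_sum c (Z.of_nat n) (Z.of_nat n) w = 0).
  { intros n w Hn; rewrite quad_sum_split, sparse_quad_sum by (try assumption; lia).
    destruct n as [|[|[|[|n]]]]; try lia; rewrite ?c1, ?c2, ?c3; ring. }
  rewrite (Hlow 2%nat), (Hlow 1%nat), quad_sum_at_0 by (try assumption; lia).
  replace (_ + _ + _ + _)%Z with 840%Z by reflexivity.
  transitivity (840 * c 6%nat + g3); [ring|exact c6]. }
assert (Hg0 : forall n, g n = 0).
{ apply (conv_deriv_uniqueness (shift c)).
  - reflexivity.
  - exact c0.
  - assert (HT1 : expands T1 (deriv (shift c))).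
    { destruct Hexp as (_ & _ & _ & _ & _ & Hloc).
      destruct (expands_derive _ _ H0) as [Hd _]; revert Hd.
      apply expands_ext; [|reflexivity].
      revert Hloc; apply filter_imp; intros z Hz; apply is_C_derive_unique, Hz. }
    apply (expands_unique (fun z => C_derive G z * T0 z) (fun z => 4 * (T1 z * G z))).
    + apply expands_mult; [apply expands_derive, Hg|exact H0].
    + apply (expands_scal 4 (fun z => T1 z * G z)), expands_mult; assumption.
    + destruct Hexp as (_ & _ & _ & _ & _ & Hloc).
      unfold locally', within in *; generalize (filter_and _ _ HH Hloc).
      apply filter_imp; intros z [Hz [_ [D0 [D1 [D2 D3]]]]] Hz0.
      apply (quartic_derivative g2 lam g3 z T0 T1 T2 T3 T4); auto.
  - rewrite <- e6, <- He; reflexivity. }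
intros n.
assert (en : e n = 0) by (rewrite <- He; destruct n as [|[|n]]; simpl; auto).
unfold e in en; unfold tau_recursion; cbv zeta in *.
(* At n = 0 the four corners coincide and cannot be split off; there the left factor is 0 and all
   sums are empty. *)
destruct n as [|n].
- unfold S4, S5, S6; simpl Z.of_nat; rewrite !quad_sum_neg by lia; simpl; ring.
- rewrite quad_sum_split in en by (try assumption; lia).
  set (N := Z.of_nat (S n)) in *; set (q := quad_sum c N (N - 1) btilde) in *.
  replace (btilde N 0 0 0 + btilde 0 N 0 0 + btilde 0 0 N 0 + btilde 0 0 0 N)%Z with
    (4 * N * (N ^ 2 - 1))%Z in en by (unfold btilde; ring).
  set (K := RtoC (IZR (4 * N * (N ^ 2 - 1))%Z)) in *.
  transitivity (K * c (S n) + q - g2 * S4 c N - 12 * lam * S5 c N + g3 * S6 c N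
    + (- q + g2 * S4 c N + 12 * lam * S5 c N - g3 * S6 c N)); [ring|rewrite en; ring].
Qed.

(** For n >= 2 the factor 4n(n^2 - 1) is nonzero and every sum on the right involves only indices
    below n; for n = 0 and n = 1 the factor vanishes, so these two values are prescribed. *)
Lemma tau_recursion_unique (g2 lam g3 : C) (c d : nat -> C) :
  c 0%nat = d 0%nat -> c 1%nat = d 1%nat ->
  (forall n, tau_recursion g2 lam g3 c n) -> (forall n, tau_recursion g2 lam g3 d n) ->
  forall n, c n = d n.
Proof.
intros E0 E1 Hc Hd n; induction n as [n IH] using lt_wf_ind.
destruct n as [|[|n]]; [exact E0|exact E1|].
specialize (Hc (S (S n))); specialize (Hd (S (S n))).
unfold tau_recursion, S4, S5, S6 in Hc, Hd; cbv zeta in Hc, Hd.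
set (N := Z.of_nat (S (S n))) in *.
assert (Hq : forall a b w, (b < N)%Z -> quad_sum c a b w = quad_sum d a b w).
{ intros a b w Hb; apply quad_sum_ext; intros j k l m Hj Hk Hl Hm _.
  rewrite !IH by (unfold N in *; lia); reflexivity. }
rewrite !Hq in Hc by lia; rewrite <- Hd in Hc.
set (K := RtoC (IZR (4 * N * (N ^ 2 - 1))%Z)) in *.
assert (HK : K <> 0).
{ unfold K; intros E; apply RtoC_inj, eq_IZR in E.
  assert (2 <= N)%Z by (unfold N; lia); nia. }
replace (c (S (S n))) with (/ K * (K * c (S (S n)))) by (field; exact HK).
rewrite Hc; field; exact HK.
Qed.

Theorem theorem4p3 (g2 lam g3 : C) (u tau : C -> C) (c : nat -> C)
  (hu : painleve1_solution g2 lam g3 u)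
  (htau : normalized_tau_function u tau)
  (hc : tau_taylor tau c) :
  (c 0%nat = 1 /\ c 1%nat = 0 /\ forall n, tau_recursion g2 lam g3 c n) /\
  (forall d : nat -> C,
     d 0%nat = 1 -> d 1%nat = 0 ->
     (forall n, tau_recursion g2 lam g3 d n) ->
     forall n, d n = c n).
Proof.
destruct hu as [_ [Hode [a [a0 [a6 Ha]]]]].
destruct htau as [Htau [_ [Ht1 Ht2]]].
assert (H0 := tau_taylor_expands tau c hc).
assert (Hexp := tau_taylor_expansions tau c hc).
destruct (expands_derive _ _ H0) as [H1 _].
destruct (expands_derive _ _ H1) as [H2 _].
assert (c0 : c 0%nat = 1).
{ rewrite <- Ht1, (expands_at_0 _ _ H1); unfold deriv; simpl; ring. }
assert (c1 : c 1%nat = 0).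
{ rewrite (expands_at_0 _ _ H2) in Ht2; unfold deriv, shift in Ht2.
  replace (c 1%nat) with (/ 2 * (INR 1 * (INR 2 * c 1%nat))).
  - rewrite Ht2; ring.
  - simpl; rewrite RtoC_plus; field; intros E; rewrite <- RtoC_plus in E; apply RtoC_inj in E; lra. }
assert (Hnz := tau_punctured_neq0 _ _ _ _ _ _ _ c0 Hexp).
(* Each point of a small punctured disc has a full neighbourhood free of zeros of tau, as the double
   differentiation of [u] requires. *)
assert (Hgood : locally' (0 : C) (fun z : C => locally z (fun w : C =>
  Cderives tau w (C_derive tau w) /\
  Cderives (C_derive tau) w (C_derive (C_derive tau) w) /\
  Cderives (C_derive (C_derive tau)) w (C_derive (C_derive (C_derive tau)) w) /\
  Cderives (C_derive (C_derive (C_derive tau))) w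
    (C_derive (C_derive (C_derive (C_derive tau))) w) /\
  tau w <> 0 /\
  u w = (C_derive tau w ^ 2 - tau w * C_derive (C_derive tau) w) / tau w ^ 2))).
{ destruct Hexp as (_ & _ & _ & _ & _ & Hloc).
  unfold locally', within.
  generalize (filter_and _ _ (locally_locally _ _ Hloc) Hnz).
  apply filter_imp; intros z [Hz [_ Hz1]] Hz0; specialize (Hz1 Hz0).
  destruct (locally_singleton _ _ Hz) as [_ [Dz _]].
  generalize (filter_and _ _ Hz (Cderives_neq0 _ _ _ Dz Hz1)).
  apply filter_imp; intros w [[_ [D0 [D1 [D2 D3]]]] Hw].
  do 5 (split; [assumption|]).
  exact (tau_function_formula u tau w _ Htau Hw D1). }
assert (HH : locally' (0 : C) (fun z : C =>
  tau z * C_derive (C_derive (C_derive (C_derive tau))) z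
  - 4 * C_derive tau z * C_derive (C_derive (C_derive tau)) z
  + 3 * C_derive (C_derive tau) z ^ 2 = (6 * lam * z + g2 / 2) * tau z ^ 2)).
{ unfold locally', within in *; revert Hgood; apply filter_imp; intros z Hz Hz0.
  exact (painleve1_bilinear g2 lam z u _ _ _ _ _ (Hz Hz0) (Hode z)). }
destruct (bilinear_low_coeffs c g2 lam _ _ _ _ _ _ c0 c1 Hexp HH) as [c2 c3].
assert (c6 : a 6%nat = - (30) * c 6%nat).
{ apply (laurent_coeff_6 c a u _ _ _ _ _ _ c0 c1 c2 c3 Hexp a0 Ha).
  unfold locally', within in *; revert Hgood; apply filter_imp; intros z Hz Hz0.
  apply (locally_singleton _ _ (Hz Hz0)). }
assert (Hrec : forall n, tau_recursion g2 lam g3 c n).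
{ refine (expansions_recursion c g2 lam g3 _ _ _ _ _ _ c0 c1 c2 c3 _ H0 Hexp HH).
  (* The prescribed Laurent coefficient gives g3 / 28 = -30 c_6, and 28 * 30 = 840. *)
  replace g3 with (28 * (g3 / 28)) by (field; intros E; apply RtoC_inj in E; lra).
  rewrite <- a6, c6; ring. }
split; [auto|].
intros d d0 d1 Hd; apply (tau_recursion_unique g2 lam g3);
  [rewrite c0|rewrite c1| |]; assumption.
Qed.
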